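(* Let $\lambda\in\mathbb{R}\setminus\{0\}$ and let $\Omega$ be a domain in $\mathbb{R}^2$. If $u$ is a real-valued solution of the Helmholtz equation $\nabla^2u+\lambda^2u=0$ in $\Omega$, then $$\tilde a(\lambda r)\,u(x)=\frac{1}{\pi r^2}\int_{D_r(x)}u(y)\log\frac{r}{|x-y|}\,dy,\qquad \tilde a(t)=\frac{2\,[1-J_0(t)]}{t^2},$$ for every admissible disc $D_r(x)$.
   Context: For $x\in\mathbb{R}^2$ and $r>0$, $D_r(x)=\{y\in\mathbb{R}^2:|y-x|<r\}$ is the open disc of radius $r$ centred at $x$; it is called admissible with respect to a domain $\Omega\subset\mathbb{R}^2$ if $\overline{D_r(x)}\subset\Omega$. $\nabla^2=\partial^2/\partial x_1^2+\partial^2/\partial x_2^2$, and $J_0$ denotes the Bessel function of the first kind of order $0$. *)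

(* Defs.v *)
From HB Require Import structures.
From mathcomp Require Import all_boot all_order all_algebra.
From mathcomp Require Import all_classical all_reals all_analysis.

Set Implicit Arguments.
Unset Strict Implicit.
Unset Printing Implicit Defensive.

Import Order.TTheory GRing.Theory Num.Theory.
Import numFieldNormedType.Exports.

Local Open Scope classical_set_scope.
Local Open Scope ring_scope.

(* The library norm on [R * R] is the sup norm; it induces the usual topology,
   but the discs are Euclidean. *)
Definition euclid {R : realType} (p : R * R) : R :=
  Num.sqrt (p.1 ^+ 2 + p.2 ^+ 2).

Definition disc {R : realType} (x : R * R) (r : R) : set (R * R) :=
  [set y | euclid (y - x) < r].

Definition plane_domain {R : realType} (Omega : set (R * R)) : Prop :=
  [/\ Omega !=set0, open Omega & connected Omega].

Definition admissible {R : realType} (Omega : set (R * R)) (x : R * R) (r : R)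
  : Prop := 0 < r /\ closure (disc x r) `<=` Omega.

Definition partial1 {R : realType} (u : R * R -> R) : R * R -> R :=
  fun x => 'D_((1, 0) : R * R) u x.

Definition partial2 {R : realType} (u : R * R -> R) : R * R -> R :=
  fun x => 'D_((0, 1) : R * R) u x.

(* Functions are total on [R * R]; for open [Omega] everything below depends
   only on their values in [Omega]. *)
Definition C1_on {R : realType} (Omega : set (R * R)) (u : R * R -> R) : Prop :=
  forall x, Omega x ->
    [/\ derivable u x ((1, 0) : R * R), derivable u x ((0, 1) : R * R),
        {for x, continuous (partial1 u)} & {for x, continuous (partial2 u)}].

Definition C2_on {R : realType} (Omega : set (R * R)) (u : R * R -> R) : Prop :=
  [/\ C1_on Omega u, C1_on Omega (partial1 u) & C1_on Omega (partial2 u)].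

Definition laplacian {R : realType} (u : R * R -> R) (x : R * R) : R :=
  partial1 (partial1 u) x + partial2 (partial2 u) x.

(* Classical solutions. *)
Definition helmholtz_solution {R : realType} (Omega : set (R * R)) (lambda : R)
    (u : R * R -> R) : Prop :=
  C2_on Omega u /\
  (forall x, Omega x -> laplacian u x + lambda ^+ 2 * u x = 0).

Definition bessel_J0 {R : realType} (t : R) : R :=
  limn (series (fun k : nat => (-1) ^+ k / (k`!%:R ^+ 2) * (t / 2) ^+ (2 * k))).

Definition a_tilde {R : realType} (t : R) : R :=
  2 * (1 - bessel_J0 t) / t ^+ 2.

(* Main.v *)
Require Import Defs.
From HB Require Import structures.
From mathcomp Require Import all_boot all_order all_algebra.
From mathcomp Require Import all_classical all_reals all_analysis.
From mathcomp Require Import measurable_realfun ring lra.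

(** Averaging u over the disc against the powers of the weight
    w(y) = 1 - |y - x|^2 / r^2 turns the Helmholtz equation into a recurrence
    between numbers, and the logarithmic kernel into a sum of those averages.

    Let M_n be (n+1) / (pi r^2) times the integral of w^n u over the disc, and let
    kappa = (lambda r / 2)^2.  For n >= 2 the power w^n vanishes to second order on
    the circle, so Green's identity for w^n and u has no boundary term; since the
    Laplacian of w^n is a combination of w^(n-1) and w^(n-2), replacing that
    of u by - lambda^2 u gives
      M_n - M_(n+1) = - kappa M_(n+2) / ((n+2)(n+3)),
    which is [mean_moment_recurrence].  In this form Green's identity is an
    integration along horizontal and along vertical chords followed by Fubini's
    theorem, and no polar coordinates are needed.  For u = 1 and lambda = 0 the
    recurrence says that M_n is constant; as the area of the disc is pi r^2, the
    functions (n+1) w^n / (pi r^2) are probability densities, and since they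
    concentrate at x, M_n tends to u(x) ([mean_moment_cvg]).

    Put M_(-1) = M_0 - kappa M_1 / 2, so that the recurrence also holds for n = -1.
    A solution of the recurrence is determined by its limit at infinity
    ([backward_recurrence_unique]), and the Bessel-Clifford functions, the first
    of which is J_0(lambda r), form a solution with limit 1.  Therefore
    M_(-1) = J_0(lambda r) u(x) ([bessel_of_recurrence]); this number is the mean
    of u over the circle.

    Finally log (r / |x - y|) = - log (1 - w) / 2 is half the sum over k >= 1 of
    w^k / k, so that the integral of the theorem is pi r^2 / 2 times the sum of
    M_k / (k (k+1)) ([log_weight_integral]).  By the recurrence kappa times this
    sum telescopes to u(x) - M_(-1) = (1 - J_0(lambda r)) u(x)
    ([log_moment_sum]), and (1 - J_0(lambda r)) / (2 kappa) is the value
    of the coefficient at lambda r. *)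

Set Implicit Arguments.
Unset Strict Implicit.
Unset Printing Implicit Defensive.

Import Order.TTheory GRing.Theory Num.Theory.
Import numFieldNormedType.Exports.
Local Open Scope classical_set_scope.
Local Open Scope ring_scope.

(** The product measurable space underlying the planar Lebesgue measure; its
    measurable structure differs syntactically from the one inferred on R * R. *)
Local Notation plane R := (measurableTypeR R * measurableTypeR R)%type.
Local Notation mu2 := (lebesgue_measure \x lebesgue_measure)%E.

(** * Borel sets and continuous functions of the plane *)

(** An open set of the plane is the union of the countably many rational squares
    that it contains, and squares are measurable rectangles.  The type of U is
    fixed to the product on which the planar measure is built. *)
Lemma open_measurable_prod (R : realType) (U : set (R * R)) :
  open U -> measurable (U : set (plane R)).
Proof.
move=> oU.
pose B (i : rat * rat * rat) : set (plane R) :=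
  ball (ratr i.1.1 : R) (ratr i.2) `*` ball (ratr i.1.2 : R) (ratr i.2).
rewrite (_ : U = \bigcup_(i : rat * rat * rat)
                  (if pselect (B i `<=` U) then B i else set0)).
  apply: countable_bigcupT_measurable => // i.
  case: pselect => BU; last exact: measurable0.
  by apply: measurableX; rewrite ball_itv; exact: measurable_itv.
apply/seteqP; split=> [y Uy|y [i _]]; last first.
  by case: pselect => [BU /= /BU|].
have /nbhs_ballP[d /= d0 dU] : nbhs y U by exact: open_nbhs_nbhs.
have d20 : 0 < d / 2 by rewrite divr_gt0.
have [e] := rat_in_itvoo d20; rewrite in_itv/= => /andP[e0 ed].
have [p] : exists p : rat, ratr p \in `]y.1 - ratr e, y.1 + ratr e[.
  by apply: rat_in_itvoo; rewrite ltrD2l gtrN.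
have [q] : exists q : rat, ratr q \in `]y.2 - ratr e, y.2 + ratr e[.
  by apply: rat_in_itvoo; rewrite ltrD2l gtrN.
rewrite !in_itv/= => /andP[q1 q2] /andP[p1 p2].
exists (p, q, e) => //; case: pselect => [BU|]; last first.
  case=> z [/=]; rewrite /ball/= !ltr_norml => /andP[z1 z2] /andP[z3 z4].
  by apply: dU; split; rewrite /ball/= ltr_norml; apply/andP; split; lra.
by split; rewrite /ball/= ltr_norml; apply/andP; split; lra.
Qed.

Lemma continuous_open_measurable_fun (R : realType) (D : set (R * R))
    (f : R * R -> R) :
  open D -> (forall y, D y -> {for y, continuous f}) ->
  measurable_fun D (f : plane R -> R).
Proof.
move=> oD cf mD; apply: (measurability _ (RGenOpens.measurableE R)) => //.
move=> _ [_ [a [b ->] <-]]; apply: open_measurable_prod.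
rewrite openE => y [Dy fy]; rewrite /interior.
apply: filterI; first exact: open_nbhs_nbhs.
by apply: (cf y Dy); apply: open_nbhs_nbhs; split => //; exact: interval_open.
Qed.

(** * Partial derivatives as derivatives along lines *)

Lemma lipschitz_of_bounded_derive (R : realType) (f df : R -> R) (a b M : R) :
  (forall t, `|t - a| <= `|b - a| ->
     is_derive t 1 f (df t) /\ `|df t| <= M) ->
  `|f b - f a| <= M * `|b - a|.
Proof.
suff main (c d : R) : c <= d ->
    (forall t, t \in `[c, d] -> is_derive t 1 f (df t) /\ `|df t| <= M) ->
    `|f d - f c| <= M * `|d - c|.
  move=> H; have [ab|ba] := leP a b.
    apply: main => // t; rewrite in_itv/= => /andP[at_ tb]; apply: H.
    by rewrite !ger0_norm ?subr_ge0// lerD2r.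
  rewrite distrC [X in _ * X]distrC; apply: main; first exact: ltW.
  move=> t; rewrite in_itv/= => /andP[bt ta]; apply: H.
  by rewrite distrC [leRHS]distrC !ger0_norm ?subr_ge0// ?(ltW ba)// lerB.
move=> cd H.
have [||t tcd ->] := @MVT_segment R f df c d cd.
- by move=> t /subset_itv_oo_cc /H[].
- apply: derivable_within_continuous => t /H[dft _].
  exact: ex_derive.
by rewrite normrM ler_wpM2r//; have [] := H t tcd.
Qed.

Lemma is_derive_line1 (R : realType) (u : R * R -> R) (p : R * R) :
  derivable u p ((1, 0) : R * R) ->
  is_derive p.1 1 (fun t => u (t, p.2)) (partial1 u p).
Proof.
have E : (fun h : R => h^-1 *: (((fun t => u (t, p.2)) \o shift p.1) (h *: 1)
             - u (p.1, p.2)))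
    = (fun h : R => h^-1 *: ((u \o shift p) (h *: ((1, 0) : R * R)) - u p)).
  apply/funext => h /=; rewrite -surjective_pairing; congr (_ *: (_ - _)).
  by case: p => p1 p2 /=; congr u; apply/pair_equal_spec; rewrite /= ?scaler0 ?add0r.
move=> du; split; last by rewrite /partial1 /derive E.
by rewrite /derivable E.
Qed.

Lemma is_derive_line2 (R : realType) (u : R * R -> R) (p : R * R) :
  derivable u p ((0, 1) : R * R) ->
  is_derive p.2 1 (fun t => u (p.1, t)) (partial2 u p).
Proof.
have E : (fun h : R => h^-1 *: (((fun t => u (p.1, t)) \o shift p.2) (h *: 1)
             - u (p.1, p.2)))
    = (fun h : R => h^-1 *: ((u \o shift p) (h *: ((0, 1) : R * R)) - u p)).
  apply/funext => h /=; rewrite -surjective_pairing; congr (_ *: (_ - _)).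
  by case: p => p1 p2 /=; congr u; apply/pair_equal_spec; rewrite /= ?scaler0 ?add0r.
move=> du; split; last by rewrite /partial2 /derive E.
by rewrite /derivable E.
Qed.

(** Joining two points by a horizontal and a vertical segment, on which the
    partial derivatives are bounded, shows that u is locally Lipschitz. *)
Lemma C1_on_continuous (R : realType) (Omega : set (R * R)) (u : R * R -> R) :
  open Omega -> C1_on Omega u -> forall y, Omega y -> {for y, continuous u}.
Proof.
move=> oO C1 y Oy; have [_ _ c1 c2] := C1 y Oy.
pose M := `|partial1 u y| + `|partial2 u y| + 1.
have /nbhs_ballP[d /= d0 dP] : nbhs y [set z | [/\ Omega z,
    `|partial1 u z| <= M & `|partial2 u z| <= M]].
  near=> z; split; first by near: z; exact: open_nbhs_nbhs.
    have : `|partial1 u y - partial1 u z| < 1.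
      by near: z; move/cvgrPdist_lt : c1; apply.
    rewrite /M; move: (partial1 u z) (partial1 u y) (normr_ge0 (partial2 u y)).
    move=> a b ? ?; have := ler_distD b 0 a; rewrite !sub0r !normrN. lra.
  have : `|partial2 u y - partial2 u z| < 1.
    by near: z; move/cvgrPdist_lt : c2; apply.
  rewrite /M; move: (partial2 u z) (partial2 u y) (normr_ge0 (partial1 u y)).
  move=> a b ? ?; have := ler_distD b 0 a; rewrite !sub0r !normrN. lra.
have M0 : 0 < M by rewrite /M ltr_wpDl// addr_ge0.
have lip z : ball y d z -> `|u z - u y| <= M * (`|z.1 - y.1| + `|z.2 - y.2|).
  move=> [/= z1 z2].
  rewrite (_ : u z - u y = (u z - u (z.1, y.2)) + (u (z.1, y.2) - u y)); last lra.
  rewrite mulrDr [leRHS]addrC (le_trans (ler_normD _ _))// lerD//.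
    have := @lipschitz_of_bounded_derive R (fun t => u (z.1, t))
       (fun t => partial2 u (z.1, t)) y.2 z.2 M.
    rewrite /= -surjective_pairing; apply => t tz.
    have [Ot _ ?] : [/\ Omega (z.1, t), `|partial1 u (z.1, t)| <= M &
        `|partial2 u (z.1, t)| <= M].
      apply: dP; split; first exact: z1.
      by rewrite /ball/= distrC (le_lt_trans tz)// distrC.
    split => //; have [_ du _ _] := C1 _ Ot.
    exact: (@is_derive_line2 R u (z.1, t)).
  have := @lipschitz_of_bounded_derive R (fun t => u (t, y.2))
     (fun t => partial1 u (t, y.2)) y.1 z.1 M.
  rewrite /= -surjective_pairing; apply => t tz.
  have [Ot ? _] : [/\ Omega (t, y.2), `|partial1 u (t, y.2)| <= M &
      `|partial2 u (t, y.2)| <= M].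
    apply: dP; split; last exact: ballxx.
    by rewrite /ball/= distrC (le_lt_trans tz)// distrC.
  split => //; have [du _ _ _] := C1 _ Ot.
  exact: (@is_derive_line1 R u (t, y.2)).
apply/cvgrPdist_lt => e e0.
pose d' := Num.min d (e / (2 * M)).
have d'0 : 0 < d' by rewrite lt_min d0 divr_gt0// mulr_gt0.
change (nbhs y [set t | `|u y - u t| < e]).
apply/nbhs_ballP; exists d' => // z zd'.
have : ball y (e / (2 * M)) z by apply: le_ball zd'; rewrite ge_min lexx orbT.
move=> [/= z1 z2]; rewrite distrC (le_lt_trans (lip z _))//.
  by apply: le_ball zd'; rewrite ge_min lexx.
rewrite -ltr_pdivlMl// (_ : M^-1 * e = e / (2 * M) + e / (2 * M)).
  by rewrite distrC [`|z.2 - _|]distrC ltrD.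
by field; rewrite gt_eqF.
Unshelve. all: by end_near. Qed.

(** * Discs and the weight that vanishes on their boundary *)

Definition disc_weight {R : realType} (x : R * R) (r : R) (y : R * R) : R :=
  1 - ((y.1 - x.1) ^+ 2 + (y.2 - x.2) ^+ 2) / r ^+ 2.

Definition closed_disc {R : realType} (x : R * R) (r : R) : set (R * R) :=
  [set y | (y.1 - x.1) ^+ 2 + (y.2 - x.2) ^+ 2 <= r ^+ 2].

Lemma euclid_ge0 (R : realType) (p : R * R) : 0 <= euclid p.
Proof. exact: sqrtr_ge0. Qed.

Lemma sqr_euclid (R : realType) (p : R * R) :
  euclid p ^+ 2 = p.1 ^+ 2 + p.2 ^+ 2.
Proof. by rewrite sqr_sqrtr// addr_ge0// sqr_ge0. Qed.

Lemma disc_sqrE (R : realType) (x : R * R) (r : R) (y : R * R) : 0 < r ->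
  disc x r y <-> (y.1 - x.1) ^+ 2 + (y.2 - x.2) ^+ 2 < r ^+ 2.
Proof.
move=> r0; rewrite /disc /mkset.
by rewrite -(@ltr_pXn2r _ 2) ?nnegrE ?euclid_ge0 ?ltW// sqr_euclid.
Qed.

Lemma disc_weight_gt0 (R : realType) (x : R * R) (r : R) (y : R * R) : 0 < r ->
  disc x r y <-> 0 < disc_weight x r y.
Proof.
move=> r0; rewrite disc_sqrE// /disc_weight subr_gt0 ltr_pdivrMr ?exprn_gt0//.
by rewrite mul1r.
Qed.

Lemma disc_weight_le1 (R : realType) (x : R * R) (r : R) (y : R * R) :
  disc_weight x r y <= 1.
Proof. by rewrite gerBl divr_ge0 ?addr_ge0 ?sqr_ge0. Qed.

Lemma disc_weight_center (R : realType) (x : R * R) (r : R) :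
  disc_weight x r x = 1.
Proof. by rewrite /disc_weight !subrr expr0n/= addr0 mul0r subr0. Qed.

Lemma disc_weight_continuous (R : realType) (x : R * R) (r : R) :
  continuous (disc_weight x r).
Proof.
move=> y; apply: cvgB; first exact: cvg_cst.
apply: cvgMl; apply: cvgD; apply: (@cvg_comp _ _ _ _ (fun t : R => t ^+ 2));
  try exact: exprn_continuous; apply: cvgB; try exact: cvg_cst.
  exact: cvg_fst.
exact: cvg_snd.
Qed.

Lemma disc_open (R : realType) (x : R * R) (r : R) : 0 < r -> open (disc x r).
Proof.
move=> r0; rewrite (_ : disc x r = disc_weight x r @^-1` [set t | 0 < t]).
  apply: open_comp; last exact: open_gt.
  by move=> y _; exact: disc_weight_continuous.
by apply/seteqP; split=> y /(disc_weight_gt0 x y r0).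
Qed.

Lemma disc_measurable (R : realType) (x : R * R) (r : R) :
  0 < r -> measurable (disc x r : set (plane R)).
Proof. by move=> r0; exact: open_measurable_prod (disc_open r0). Qed.

Lemma disc_sub_closed_disc (R : realType) (x : R * R) (r : R) : 0 < r ->
  disc x r `<=` closed_disc x r.
Proof. by move=> r0 y /(disc_sqrE _ _ r0)/ltW. Qed.

Lemma closed_disc_sub_box (R : realType) (x : R * R) (r : R) : 0 < r ->
  closed_disc x r `<=` `[x.1 - r, x.1 + r]%classic `*` `[x.2 - r, x.2 + r]%classic.
Proof.
move=> r0 y; rewrite /closed_disc /= !in_itv/= -!ler_distl => H.
have abs_le (a : R) : a ^+ 2 <= r ^+ 2 -> `|a| <= r.
  by move=> ar; rewrite -(@ler_pXn2r _ 2) ?nnegrE ?(ltW r0)// real_normK ?num_real.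
split; apply: abs_le; apply: le_trans H.
  by rewrite lerDl sqr_ge0.
by rewrite lerDr sqr_ge0.
Qed.

(** A point y of the closed disc is a limit of points of the open segment from x
    to y, which lie in the open disc. *)
Lemma closed_disc_sub_closure (R : realType) (x : R * R) (r : R) : 0 < r ->
  closed_disc x r `<=` closure (disc x r).
Proof.
move=> r0 y Ky B /nbhs_ballP[e /= e0 eB].
have [/=] := closed_disc_sub_box r0 Ky; rewrite !in_itv/=.
move=> /andP[y1 y2] /andP[y3 y4].
have re0 : 0 < r + e by rewrite addr_gt0.
(* any s between 0 and 1 with (1 - s) r < e would do *)
pose s := r / (r + e).
have s0 : 0 < s by rewrite divr_gt0.
have s1 : s < 1 by rewrite ltr_pdivrMr// mul1r ltrDl.
have sE : (1 - s) * r < e.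
  rewrite (_ : (1 - s) * r = s * e); last first.
    by rewrite /s; field; rewrite gt_eqF.
  by rewrite gtr_pMl.
have B1 (a b : R) : b - r <= a -> a <= b + r ->
    `|a - (b + s * (a - b))| < e.
  move=> ba ab; rewrite (_ : a - _ = (1 - s) * (a - b)); last by ring.
  rewrite normrM gtr0_norm ?subr_gt0// (le_lt_trans _ sE)//.
  by rewrite ler_wpM2l ?subr_ge0 ?(ltW s1)// ler_norml; apply/andP; split; lra.
clearbody s.
exists (x.1 + s * (y.1 - x.1), x.2 + s * (y.2 - x.2)); split.
  apply/disc_sqrE => //=; rewrite [x.1 + _]addrC [x.2 + _]addrC !addrK.
  rewrite !exprMn -mulrDr; apply: (@le_lt_trans _ _ (s ^+ 2 * r ^+ 2)).
    by rewrite ler_wpM2l// sqr_ge0.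
  by rewrite gtr_pMl ?exprn_gt0// expr_lt1// ltW.
by apply: eB; split => /=; exact: B1.
Qed.

Lemma closed_disc_compact (R : realType) (x : R * R) (r : R) : 0 < r ->
  compact (closed_disc x r).
Proof.
move=> r0; apply: (subclosed_compact _ _ (closed_disc_sub_box r0)).
  rewrite (_ : closed_disc x r = disc_weight x r @^-1` [set t | 0 <= t]).
    apply: closed_comp; last exact: closed_ge.
    by move=> y _; exact: disc_weight_continuous.
  apply/seteqP; split=> y; rewrite /closed_disc /disc_weight /=;
    by rewrite subr_ge0 ler_pdivrMr ?exprn_gt0// mul1r.
by apply: compact_setX; exact: segment_compact.
Qed.

Lemma closed_disc_bounded (R : realType) (x : R * R) (r : R) (f : R * R -> R) :
  0 < r -> (forall y, closed_disc x r y -> {for y, continuous f}) ->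
  exists2 M, 0 < M & forall y, closed_disc x r y -> `|f y| <= M.
Proof.
move=> r0 cf.
have [||c _ cmax] := @compact_EVT_max _ R (fun y => `|f y|) (closed_disc x r)
  _ (closed_disc_compact r0).
- by exists x; rewrite /closed_disc /= !subrr expr0n/= addr0 sqr_ge0.
- apply: continuous_in_subspaceT => y /set_mem Ky.
  apply: (@continuous_comp _ _ _ f (fun t : R => `|t|)); first exact: cf.
  exact: norm_continuous.
exists (`|f c| + 1); first by rewrite ltr_wpDl.
by move=> y Ky; rewrite (le_trans (cmax y _)) ?inE// lerDl.
Qed.

(** * Integrals along the chords of a disc *)

Lemma integral_derive_eq0 (R : realType) (F f : R -> R) (a b : R) : a < b ->
  (forall t, t \in `[a, b] -> is_derive t 1 F (f t)) ->
  {within `[a, b], continuous f} -> F a = F b ->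
  (\int[lebesgue_measure]_(t in `]a, b[) (f t)%:E = 0)%E.
Proof.
move=> ab dF cf FE.
have cF : {within `[a, b], continuous F}.
  by apply: derivable_within_continuous => t /dF dFt; exact: ex_derive.
have mf : measurable_fun `[a, b] f by exact: subspace_continuous_measurable_fun.
rewrite integral_itv_obnd_cbnd; last first.
  apply/measurable_EFinP; apply: measurable_funS mf => //.
  exact: subset_itv_oo_cc.
rewrite integral_itv_bndo_bndc; last first.
  apply/measurable_EFinP; apply: measurable_funS mf => //.
  exact: subset_itv_co_cc.
rewrite (@continuous_FTC2 R f F a b ab cf) ?FE ?subee//; last first.
  move=> t /subset_itv_oo_cc tab.
  by rewrite derive1E; apply: derive_val; exact: dF.
have [_ Fa Fb] := (continuous_within_itvP F ab).1 cF.
by split => // t /subset_itv_oo_cc /dF dFt; exact: ex_derive.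
Qed.

Definition half_chord {R : realType} (r s : R) : R := Num.sqrt (r ^+ 2 - s ^+ 2).

Lemma half_chordP (R : realType) (r s t : R) :
  t ^+ 2 + s ^+ 2 < r ^+ 2 <-> `|t| < half_chord r s.
Proof.
rewrite /half_chord.
rewrite -[in X in _ <-> X](@ltr_pXn2r _ 2) ?nnegrE ?sqrtr_ge0//.
rewrite real_normK ?num_real//.
have [rs|rs] := lerP 0 (r ^+ 2 - s ^+ 2).
  by rewrite sqr_sqrtr// ltrBrDr.
rewrite ltr0_sqrtr// expr0n/=; split; last by rewrite ltNge sqr_ge0.
by move: rs; have := sqr_ge0 t; lra.
Qed.

Lemma disc_row (R : realType) (x : R * R) (r s : R) : 0 < r ->
  [set t | disc x r (t, s)] =
  `]x.1 - half_chord r (s - x.2), x.1 + half_chord r (s - x.2)[%classic.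
Proof.
move=> r0; apply/seteqP; split=> t; rewrite /mkset in_itv/= -ltr_distl.
  by move/(disc_sqrE _ _ r0)/half_chordP.
by move=> H; apply/(disc_sqrE _ _ r0)/half_chordP.
Qed.

Lemma disc_column (R : realType) (x : R * R) (r t : R) : 0 < r ->
  [set s | disc x r (t, s)] =
  `]x.2 - half_chord r (t - x.1), x.2 + half_chord r (t - x.1)[%classic.
Proof.
move=> r0; apply/seteqP; split=> s; rewrite /mkset in_itv/= -ltr_distl.
  by move/(disc_sqrE _ _ r0) => /=; rewrite addrC => /half_chordP.
by move=> H; apply/(disc_sqrE _ _ r0); rewrite addrC; exact/half_chordP.
Qed.

Lemma half_chord_gt0 (R : realType) (r s : R) :
  (0 < half_chord r s) = (s ^+ 2 < r ^+ 2).
Proof. by rewrite sqrtr_gt0 subr_gt0. Qed.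

Lemma disc_finite_measure (R : realType) (x : R * R) (r : R) : 0 < r ->
  ((lebesgue_measure \x lebesgue_measure) (disc x r) < +oo)%E.
Proof.
move=> r0; apply: (@le_lt_trans _ _ (mu2 (`[x.1 - r, x.1 + r]%classic `*`
    `[x.2 - r, x.2 + r]%classic))).
  apply: le_measure; rewrite ?inE.
  - exact: disc_measurable.
  - by apply: measurableX.
  - by apply: subset_trans (closed_disc_sub_box r0); exact: disc_sub_closed_disc.
rewrite product_measure1E//= !lebesgue_measure_itv/= !lte_fin.
by case: ifP => _; case: ifP => _; rewrite ?mule0 ?mul0e ?ltry.
Qed.

Lemma disc_integrable (R : realType) (x : R * R) (r : R) (g : R * R -> R) (M : R) :
  0 < r -> measurable_fun (disc x r) (g : plane R -> R) ->
  (forall y, disc x r y -> `|g y| <= M) ->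
  mu2.-integrable (disc x r) (EFin \o g).
Proof.
move=> r0 mg gM; apply: measurable_bounded_integrable => //.
- exact: disc_measurable.
- exact: disc_finite_measure.
- exists M; split; first exact: num_real.
  by move=> N MN y Dy /=; exact: le_trans (gM y Dy) (ltW MN).
Qed.

(** Fubini's theorem; the rows that miss the disc or touch the circle meet it in
    an empty interval. *)
Lemma integral_disc_rows0 (R : realType) (x : R * R) (r : R) (g : R * R -> R) :
  0 < r -> mu2.-integrable (disc x r) (EFin \o g) ->
  (forall s : R, (s - x.2) ^+ 2 < r ^+ 2 ->
    (\int[lebesgue_measure]_(t in `](x.1 - half_chord r (s - x.2))%R,
       (x.1 + half_chord r (s - x.2))%R[) (g (t, s))%:E = 0)%E) ->
  (\int[mu2]_(y in disc x r) (g y)%:E = 0)%E.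
Proof.
move=> r0 ig g0; rewrite integral_mkcond -integral21_prod_meas1; last first.
  exact: (iffLR (integrable_mkcond _ (disc_measurable x r0)) ig).
rewrite integral0_eq// => s _.
have <- : (\int[lebesgue_measure]_(t in [set t | disc x r (t, s)])
    (g (t, s))%:E = 0)%E.
  rewrite disc_row//; have [sr|sr] := ltrP ((s - x.2) ^+ 2) (r ^+ 2).
    exact: g0.
  have -> : half_chord r (s - x.2) = 0.
    by apply/eqP; rewrite sqrtr_eq0 subr_le0.
  by rewrite addr0 subr0 set_itvoo0 integral_set0.
rewrite [RHS]integral_mkcond; apply: eq_integral => t _.
by rewrite !patchE /=; congr (if _ then _ else _); apply/idP/idP; rewrite !inE.
Qed.

Lemma integral_disc_columns0 (R : realType) (x : R * R) (r : R) (g : R * R -> R) :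
  0 < r -> mu2.-integrable (disc x r) (EFin \o g) ->
  (forall t : R, (t - x.1) ^+ 2 < r ^+ 2 ->
    (\int[lebesgue_measure]_(s in `](x.2 - half_chord r (t - x.1))%R,
       (x.2 + half_chord r (t - x.1))%R[) (g (t, s))%:E = 0)%E) ->
  (\int[mu2]_(y in disc x r) (g y)%:E = 0)%E.
Proof.
move=> r0 ig g0; rewrite integral_mkcond -integral12_prod_meas1; last first.
  exact: (iffLR (integrable_mkcond _ (disc_measurable x r0)) ig).
rewrite integral0_eq// => t _.
have <- : (\int[lebesgue_measure]_(s in [set s | disc x r (t, s)])
    (g (t, s))%:E = 0)%E.
  rewrite disc_column//; have [tr|tr] := ltrP ((t - x.1) ^+ 2) (r ^+ 2).
    exact: g0.
  have -> : half_chord r (t - x.1) = 0.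
    by apply/eqP; rewrite sqrtr_eq0 subr_le0.
  by rewrite addr0 subr0 set_itvoo0 integral_set0.
rewrite [RHS]integral_mkcond; apply: eq_integral => s _.
by rewrite !patchE /=; congr (if _ then _ else _); apply/idP/idP; rewrite !inE.
Qed.

(** * The area of a disc *)

Lemma half_chord_continuous (R : realType) (c r : R) :
  continuous (fun t => half_chord r (t - c)).
Proof.
move=> t; apply: (@continuous_comp _ _ _ (fun t => r ^+ 2 - (t - c) ^+ 2) Num.sqrt).
  apply: cvgB; first exact: cvg_cst.
  apply: (@continuous_comp _ _ _ (fun t => t - c) (fun t : R => t ^+ 2)).
    by apply: cvgB => //; exact: cvg_cst.
  exact: exprn_continuous.
exact: sqrt_continuous.
Qed.

(** The substitution t = c + r sin a turns the integrand into
    2 r^2 (cos a)^2, whose primitive is r^2 (a + sin a cos a). *)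
Lemma integral_half_chord (R : realType) (c r : R) : 0 < r ->
  (\int[lebesgue_measure]_(t in `[(c - r)%R, (c + r)%R])
     (2 * half_chord r (t - c))%:E = (pi * r ^+ 2)%:E)%E.
Proof.
move=> r0; pose F (a : R) := c + r * sin a.
have dF (a : R) : is_derive a 1 F (r * cos a).
  by apply: is_derive_eq; rewrite /GRing.scale/=; ring.
have F'E : F^`()%classic = fun a => r * cos a.
  by apply/funext => a; rewrite derive1E derive_val.
have cF : continuous F by move=> a; apply/differentiable_continuous/derivable1_diffP.
have cF' : continuous F^`()%classic.
  by rewrite F'E => a; apply: cvgMr; exact: continuous_cos.
have pi2 : - (pi / 2) < pi / 2 :> R by rewrite gtrN// divr_gt0 ?pi_gt0.
rewrite (_ : c - r = F (- (pi / 2))); last first.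
  by rewrite /F sinN sin_pihalf mulrN1.
rewrite (_ : c + r = F (pi / 2)); last by rewrite /F sin_pihalf mulr1.
rewrite integration_by_substitution_increasing; last first.
- apply: continuous_subspaceT => t; apply: cvgMr; exact: half_chord_continuous.
- split => //; first by apply: cvg_at_right_filter; exact: cF.
  by apply: cvg_at_left_filter; exact: cF.
- apply/cvg_ex; exists (F^`()%classic (pi / 2)).
  by apply: cvg_at_left_filter; exact: cF'.
- apply/cvg_ex; exists (F^`()%classic (- (pi / 2))).
  by apply: cvg_at_right_filter; exact: cF'.
- by move=> a _; exact: cF'.
- by move=> a b aI bI ab; rewrite /F ltrD2l ltr_pM2l// ltr_sin.
- exact: ltW.
pose H (a : R) := r ^+ 2 * (a + sin a * cos a).
have dH (a : R) : is_derive a 1 H (r ^+ 2 * (2 * cos a ^+ 2)).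
  apply: is_derive_eq; rewrite /GRing.scale/=.
  by have := cos2Dsin2 a; nra.
have cH : continuous H by move=> a; apply/differentiable_continuous/derivable1_diffP.
rewrite (eq_integral (fun a : measurableTypeR R =>
  (r ^+ 2 * (2 * cos (a : R) ^+ 2))%:E)); last first.
  move=> a /[!inE] /= aI; rewrite F'E; congr (_%:E).
  change (2 * half_chord r (F a - c) * (r * cos a) = r ^+ 2 * (2 * cos a ^+ 2)).
  have -> : half_chord r (F a - c) = r * cos a.
    rewrite /half_chord /F addrAC subrr add0r.
    rewrite (_ : r ^+ 2 - _ = (r * cos a) ^+ 2).
      rewrite sqrtr_sqr ger0_norm// mulr_ge0 ?(ltW r0)// cos_ge0_pihalf//.
    by rewrite -[X in X - _]mulr1 -(cos2Dsin2 a); ring.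
  by rewrite /=; ring.
rewrite (@continuous_FTC2 R _ H _ _ pi2); last first.
- by move=> a _; rewrite derive1E derive_val.
- split => //; first by apply: cvg_at_right_filter; exact: cH.
  by apply: cvg_at_left_filter; exact: cH.
- apply: continuous_subspaceT => a; apply: cvgMr; apply: cvgMr.
  apply: (@continuous_comp _ _ _ cos (fun t : R => t ^+ 2)).
    exact: continuous_cos.
  exact: exprn_continuous.
rewrite -EFinB; congr (_%:E); rewrite /H cosN sinN cos_pihalf.
by field.
Qed.

Lemma disc_area (R : realType) (x : R * R) (r : R) : 0 < r ->
  (lebesgue_measure \x lebesgue_measure)%E (disc x r) = (pi * r ^+ 2)%:E.
Proof.
move=> r0; rewrite -(integral_half_chord x.1 r0) /product_measure1.
rewrite [RHS]integral_mkcond; apply: eq_integral => t _ /=.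
have -> : xsection (disc x r) t = [set s | disc x r (t, s)].
  by apply/seteqP; split => s; rewrite /xsection /= inE.
have h0 : 0 <= half_chord r (t - x.1) by exact: sqrtr_ge0.
have -> : lebesgue_measure ([set s | disc x r (t, s)] : set R) =
    (2 * half_chord r (t - x.1))%:E.
  rewrite disc_column// lebesgue_measure_itv/= lte_fin.
  move: h0; rewrite le_eqVlt => /predU1P[<-|h0].
    by rewrite subr0 addr0 ltxx mulr0.
  rewrite ifT; last by move: h0; lra.
  by rewrite -EFinB; congr (_%:E); ring.
rewrite patchE; case: ifPn => //; rewrite notin_setE /= in_itv/= -ler_distl.
move=> /negP; rewrite -ltNge => tr.
suff -> : half_chord r (t - x.1) = 0 by rewrite mulr0.
apply/eqP; rewrite sqrtr_eq0 subr_le0 -[leRHS]real_normK ?num_real//.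
by rewrite ler_pXn2r ?nnegrE ?(ltW r0)// ltW.
Qed.

(** * Green's identity for powers of the weight *)

Lemma disc_continuous_integrable (R : realType) (x : R * R) (r : R)
    (g : R * R -> R) : 0 < r ->
  (forall y, closed_disc x r y -> {for y, continuous g}) ->
  mu2.-integrable (disc x r) (EFin \o g).
Proof.
move=> r0 cg; have [M _ gM] := closed_disc_bounded r0 cg.
apply: (@disc_integrable R x r g M r0).
  apply: continuous_open_measurable_fun; first exact: disc_open.
  by move=> y /(disc_sub_closed_disc r0); exact: cg.
by move=> y /(disc_sub_closed_disc r0); exact: gM.
Qed.

(** One-dimensional Green identity for the test function P^(n+2).  The integrand
    is the derivative of P^(n+2) v' - (P^(n+2))' v, and each of its two terms
    contains a positive power of P, which is zero at the two endpoints. *)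
Lemma chord_green (R : realType) (P dP v v1 v2 : R -> R) (c a b : R) (n : nat) :
  a < b -> P a = 0 -> P b = 0 ->
  (forall t : R, is_derive t 1 P (dP t)) ->
  (forall t : R, is_derive t 1 dP c) ->
  (forall t, t \in `[a, b] -> is_derive t 1 v (v1 t)) ->
  (forall t, t \in `[a, b] -> is_derive t 1 v1 (v2 t)) ->
  {within `[a, b], continuous v2} ->
  (\int[lebesgue_measure]_(t in `]a, b[) (P t ^+ n.+2 * v2 t -
     (n.+2%:R * n.+1%:R * P t ^+ n * dP t ^+ 2 + n.+2%:R * P t ^+ n.+1 * c)
     * v t)%:E = 0)%E.
Proof.
move=> ab Pa Pb dPE ddPE dv dv1 cv2.
apply: (@integral_derive_eq0 R
  (fun t => P t ^+ n.+2 * v1 t - n.+2%:R * P t ^+ n.+1 * dP t * v t)) => //.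
- move=> t tab.
  have dvt := dv t tab; have dv1t := dv1 t tab.
  have dX m : is_derive t 1 (fun s => P s ^+ m.+1) (m.+1%:R * P t ^+ m * dP t).
    have -> : (fun s => P s ^+ m.+1) = P ^+ m.+1.
      by apply/funext => s; rewrite fctE.
    by apply: is_derive_eq; rewrite /GRing.scale/= -mulr_natl; ring.
  have dX2 := dX n.+1; have dX1 := dX n.
  apply: is_derive_eq; rewrite /GRing.scale/=.
  ring.
- have cP : {within `[a, b], continuous P}.
    by apply: derivable_within_continuous => t _; exact: ex_derive.
  have cdP : {within `[a, b], continuous dP}.
    by apply: derivable_within_continuous => t _; exact: ex_derive.
  have cv : {within `[a, b], continuous v}.
    apply: derivable_within_continuous => t tab; have dvt := dv t tab.
    exact: ex_derive.
  have cX (f : R -> R) m : {within `[a, b], continuous f} ->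
      {within `[a, b], continuous (fun y => f y ^+ m)}.
    move=> cf y.
    apply: (@continuous_comp _ _ _ (f : subspace _ -> R) (fun z : R => z ^+ m)).
      exact: cf.
    exact: exprn_continuous.
  move=> s; apply: cvgB; apply: cvgM; [exact: cX|exact: cv2| |exact: cv].
  apply: cvgD; last by apply: cvgMl; apply: cvgMr; exact: cX.
  by apply: cvgM; [apply: cvgMr; exact: cX|exact: cX].
- by rewrite Pa Pb !expr0n/= !(mul0r, mulr0).
Qed.

Lemma half_chord_sqr (R : realType) (r s : R) : s ^+ 2 < r ^+ 2 ->
  half_chord r s ^+ 2 = r ^+ 2 - s ^+ 2.
Proof. by move=> sr; rewrite sqr_sqrtr// subr_ge0 ltW. Qed.

(** Restricted to a line at distance s from the centre, the weight is a quadratic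
    polynomial that vanishes at the two ends of the chord of half-length h. *)
Lemma disc_weight_chord (R : realType) (c r s h : R) : 0 < r ->
  h ^+ 2 = r ^+ 2 - s ^+ 2 ->
  let P t := 1 - ((t - c) ^+ 2 + s ^+ 2) / r ^+ 2 in
  let dP t := - 2 * (t - c) / r ^+ 2 in
  [/\ P (c - h) = 0, P (c + h) = 0,
      forall t : R, is_derive t 1 P (dP t) &
      forall t : R, is_derive t 1 dP (- 2 / r ^+ 2)].
Proof.
move=> r0 hE /=; have r20 : r ^+ 2 != 0 by rewrite expf_neq0// gt_eqF.
split.
- by rewrite [c - h - c]addrAC subrr sub0r sqrrN hE subrK divff// subrr.
- by rewrite [c + h]addrC addrK hE subrK divff// subrr.
- move=> t; apply: is_derive_eq; rewrite /GRing.scale/=; field.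
  by rewrite gt_eqF.
- move=> t; apply: is_derive_eq; rewrite /GRing.scale/=; field.
  by rewrite gt_eqF.
Qed.

Lemma closed_disc_row (R : realType) (x : R * R) (r s t : R) : 0 < r ->
  t \in `[x.1 - half_chord r (s - x.2), x.1 + half_chord r (s - x.2)] ->
  (s - x.2) ^+ 2 < r ^+ 2 -> closed_disc x r (t, s).
Proof.
move=> r0; rewrite in_itv/= -ler_distl => th sr; rewrite /closed_disc /=.
rewrite -lerBrDr -half_chord_sqr// -[leLHS]real_normK ?num_real//.
by rewrite ler_pXn2r ?nnegrE// sqrtr_ge0.
Qed.

Lemma closed_disc_column (R : realType) (x : R * R) (r s t : R) : 0 < r ->
  s \in `[x.2 - half_chord r (t - x.1), x.2 + half_chord r (t - x.1)] ->
  (t - x.1) ^+ 2 < r ^+ 2 -> closed_disc x r (t, s).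
Proof.
move=> r0; rewrite in_itv/= -ler_distl => th sr; rewrite /closed_disc /=.
rewrite addrC -lerBrDr -half_chord_sqr// -[leLHS]real_normK ?num_real//.
by rewrite ler_pXn2r ?nnegrE// sqrtr_ge0.
Qed.

Lemma continuous_row (R : realType) (f : R * R -> R) (t s : R) :
  {for (t, s), continuous f} -> {for t, continuous (fun z => f (z, s))}.
Proof.
move=> cf; apply: (@continuous_comp _ _ _ (fun z => (z, s)) f) => //.
by apply: (@cvg_pair _ _ _ _ (nbhs t) (nbhs s)); [exact: cvg_id|exact: cvg_cst].
Qed.

Lemma continuous_column (R : realType) (f : R * R -> R) (t s : R) :
  {for (t, s), continuous f} -> {for s, continuous (fun z => f (t, z))}.
Proof.
move=> cf; apply: (@continuous_comp _ _ _ (fun z => (t, z)) f) => //.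
by apply: (@cvg_pair _ _ _ _ (nbhs t) (nbhs s)); [exact: cvg_cst|exact: cvg_id].
Qed.

(** For w the weight at a point, d one of the two coordinates of its offset from
    the centre, and f, f2 the values there of a function and of its second
    derivative in that direction, this is w^(n+2) f2 - (w^(n+2))'' f. *)
Definition green_integrand {R : realType} (r : R) (w d f f2 : R) (n : nat) : R :=
  w ^+ n.+2 * f2 - (n.+2%:R * n.+1%:R * w ^+ n * (- 2 * d / r ^+ 2) ^+ 2
     + n.+2%:R * w ^+ n.+1 * (- 2 / r ^+ 2)) * f.

Lemma continuous_green_integrand (R : realType) (x : R * R) (r : R)
    (d f f2 : R * R -> R) n y :
  {for y, continuous d} -> {for y, continuous f} -> {for y, continuous f2} ->
  {for y, continuous (fun y =>
    green_integrand r (disc_weight x r y) (d y) (f y) (f2 y) n)}.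
Proof.
move=> cd cf cf2.
have cX (g : R * R -> R) m : {for y, continuous g} ->
    {for y, continuous (fun z => g z ^+ m)}.
  move=> cg; apply: (@continuous_comp _ _ _ g (fun z : R => z ^+ m)) => //.
  exact: exprn_continuous.
have cw := @disc_weight_continuous R x r y.
apply: cvgB; apply: cvgM => //; try exact: cX.
apply: cvgD; last by apply: cvgMl; apply: cvgMr; exact: cX.
apply: cvgM; first by apply: cvgMr; exact: cX.
by apply: cX; apply: cvgMl; apply: cvgMr.
Qed.

Lemma disc_green_rows (R : realType) (x : R * R) (r : R) (u v1 v2 : R * R -> R) n :
  0 < r ->
  (forall y, closed_disc x r y ->
    [/\ is_derive y.1 1 (fun t => u (t, y.2)) (v1 y),
        is_derive y.1 1 (fun t => v1 (t, y.2)) (v2 y),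
        {for y, continuous u} & {for y, continuous v2}]) ->
  (\int[mu2]_(y in disc x r)
     (green_integrand r (disc_weight x r y) (y.1 - x.1)%R (u y) (v2 y) n)%:E = 0)%E.
Proof.
move=> r0 H; apply: (@integral_disc_rows0 R x r _ r0).
  apply: disc_continuous_integrable => // y /H[_ _ cu cv2].
  apply: continuous_green_integrand => //.
  by apply: cvgB; [exact: cvg_fst|exact: cvg_cst].
move=> s sr; set h := half_chord r (s - x.2).
have [P1 P2 dP ddP] := disc_weight_chord x.1 r0 (half_chord_sqr sr).
have h0 : 0 < h by rewrite half_chord_gt0.
have hh : x.1 - h < x.1 + h by rewrite ltrD2l gtrN.
have K t : t \in `[x.1 - h, x.1 + h] -> closed_disc x r (t, s).
  by move=> th; exact: closed_disc_row.
apply: (@chord_green R (fun t => disc_weight x r (t, s))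
  (fun t => - 2 * (t - x.1) / r ^+ 2) (fun t => u (t, s)) (fun t => v1 (t, s))
  (fun t => v2 (t, s)) _ _ _ n hh P1 P2 dP ddP).
- by move=> t /K/H[].
- by move=> t /K/H[].
- apply: continuous_in_subspaceT => t /set_mem /K/H[_ _ _].
  exact: continuous_row.
Qed.

Lemma disc_green_columns (R : realType) (x : R * R) (r : R)
    (u v1 v2 : R * R -> R) n : 0 < r ->
  (forall y, closed_disc x r y ->
    [/\ is_derive y.2 1 (fun t => u (y.1, t)) (v1 y),
        is_derive y.2 1 (fun t => v1 (y.1, t)) (v2 y),
        {for y, continuous u} & {for y, continuous v2}]) ->
  (\int[mu2]_(y in disc x r)
     (green_integrand r (disc_weight x r y) (y.2 - x.2)%R (u y) (v2 y) n)%:E = 0)%E.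
Proof.
move=> r0 H; apply: (@integral_disc_columns0 R x r _ r0).
  apply: disc_continuous_integrable => // y /H[_ _ cu cv2].
  apply: continuous_green_integrand => //.
  by apply: cvgB; [exact: cvg_snd|exact: cvg_cst].
move=> t tr; set h := half_chord r (t - x.1).
have [P1 P2 dP ddP] := disc_weight_chord x.2 r0 (half_chord_sqr tr).
have wE s : 1 - ((s - x.2) ^+ 2 + (t - x.1) ^+ 2) / r ^+ 2 =
    disc_weight x r (t, s) by rewrite /disc_weight [_ ^+ 2 + _]addrC.
rewrite !wE in P1 P2; rewrite (funext wE) in dP.
have h0 : 0 < h by rewrite half_chord_gt0.
have hh : x.2 - h < x.2 + h by rewrite ltrD2l gtrN.
have K s : s \in `[x.2 - h, x.2 + h] -> closed_disc x r (t, s).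
  by move=> th; exact: closed_disc_column.
apply: (@chord_green R (fun s => disc_weight x r (t, s))
  (fun s => - 2 * (s - x.2) / r ^+ 2) (fun s => u (t, s)) (fun s => v1 (t, s))
  (fun s => v2 (t, s)) _ _ _ n hh P1 P2 dP ddP).
- by move=> s /K/H[].
- by move=> s /K/H[].
- apply: continuous_in_subspaceT => s /set_mem /K/H[_ _ _].
  exact: continuous_column.
Qed.

(** * The recurrence between the moments of a solution *)

Definition moment {R : realType} (x : R * R) (r : R) (u : R * R -> R)
    (n : nat) : R :=
  (\int[mu2]_(y in disc x r) (disc_weight x r y ^+ n * u y))%R.

(** The factor is the reciprocal of the integral of the n-th power of the
    weight, so these are averages of u for probability densities. *)
Definition mean_moment {R : realType} (x : R * R) (r : R) (u : R * R -> R)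
    (n : nat) : R :=
  n.+1%:R / (pi * r ^+ 2) * moment x r u n.

Lemma moment_continuous (R : realType) (x : R * R) (r : R) (u : R * R -> R) n y :
  {for y, continuous u} ->
  {for y, continuous (fun y => disc_weight x r y ^+ n * u y)}.
Proof.
move=> cu; apply: cvgM; last exact: cu.
apply: (@continuous_comp _ _ _ (disc_weight x r) (fun z : R => z ^+ n)).
  exact: disc_weight_continuous.
exact: exprn_continuous.
Qed.

Lemma moment_integrable (R : realType) (x : R * R) (r : R) (u : R * R -> R) n :
  0 < r -> (forall y, closed_disc x r y -> {for y, continuous u}) ->
  mu2.-integrable (disc x r) (EFin \o (fun y => disc_weight x r y ^+ n * u y)).
Proof.
move=> r0 cu; apply: disc_continuous_integrable => // y Ky.
by apply: moment_continuous; exact: cu.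
Qed.

(** The two Green identities, along rows and along columns, add up to
    the integral of w^(n+2) lap u - lap (w^(n+2)) u being zero; the squares of
    the two offsets only enter through their sum, which is (1 - w) r^2, so that
    lap (w^(n+2)) is a combination of w^n and w^(n+1). *)
Lemma moment_recurrence (R : realType) (Omega : set (R * R)) (lambda : R)
    (u : R * R -> R) (x : R * R) (r : R) (n : nat) :
  open Omega -> helmholtz_solution Omega lambda u -> admissible Omega x r ->
  4 * n.+2%:R / r ^+ 2 * (n.+1%:R * moment x r u n - n.+2%:R * moment x r u n.+1) =
  - lambda ^+ 2 * moment x r u n.+2.
Proof.
move=> oO [[C0 C1 C2] Hu] [r0 DO].
have KO y : closed_disc x r y -> Omega y.
  by move=> Ky; apply: DO; exact: closed_disc_sub_closure.
have cu y : closed_disc x r y -> {for y, continuous u}.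
  by move=> /KO; exact: (C1_on_continuous oO C0).
pose g1 (y : R * R) := green_integrand r (disc_weight x r y) (y.1 - x.1) (u y)
  (partial1 (partial1 u) y) n.
pose g2 (y : R * R) := green_integrand r (disc_weight x r y) (y.2 - x.2) (u y)
  (partial2 (partial2 u) y) n.
have cg1 y : closed_disc x r y -> {for y, continuous g1}.
  move=> Ky; have [_ _ c _] := C1 y (KO y Ky).
  apply: (@continuous_green_integrand R x r (fun y => y.1 - x.1) u _ n y _ _ c).
    by apply: cvgB; [exact: cvg_fst|exact: cvg_cst].
  exact: cu.
have cg2 y : closed_disc x r y -> {for y, continuous g2}.
  move=> Ky; have [_ _ _ c] := C2 y (KO y Ky).
  apply: (@continuous_green_integrand R x r (fun y => y.2 - x.2) u _ n y _ _ c).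
    by apply: cvgB; [exact: cvg_snd|exact: cvg_cst].
  exact: cu.
have ig1 := disc_continuous_integrable r0 cg1.
have ig2 := disc_continuous_integrable r0 cg2.
have rows0 : (\int[mu2]_(y in disc x r) g1 y)%R = 0.
  apply: (congr1 fine (@disc_green_rows R x r u (partial1 u) _ n r0 _)).
  move=> y /[dup] Ky /KO Oy.
  have [d1 _ _ _] := C0 y Oy; have [d2 _ c2 _] := C1 y Oy.
  by split; [exact: is_derive_line1|exact: is_derive_line1|exact: cu|].
have columns0 : (\int[mu2]_(y in disc x r) g2 y)%R = 0.
  apply: (congr1 fine (@disc_green_columns R x r u (partial2 u) _ n r0 _)).
  move=> y /[dup] Ky /KO Oy.
  have [_ d1 _ _] := C0 y Oy; have [_ d2 _ c2] := C2 y Oy.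
  by split; [exact: is_derive_line2|exact: is_derive_line2|exact: cu|].
set a := 4 * n.+2%:R / r ^+ 2.
have g12 y : disc x r y -> g1 y + g2 y =
    - lambda ^+ 2 * (disc_weight x r y ^+ n.+2 * u y) -
    (a * n.+1%:R * (disc_weight x r y ^+ n * u y) -
     a * n.+2%:R * (disc_weight x r y ^+ n.+1 * u y)).
  move=> Dy; have := Hu y (KO y (disc_sub_closed_disc r0 Dy)).
  rewrite /laplacian => Ly.
  have wE : (y.1 - x.1) ^+ 2 + (y.2 - x.2) ^+ 2 = (1 - disc_weight x r y) * r ^+ 2.
    by rewrite /disc_weight; field; rewrite gt_eqF.
  have {}wE : (y.2 - x.2) ^+ 2 =
      (1 - disc_weight x r y) * r ^+ 2 - (y.1 - x.1) ^+ 2 by rewrite -wE; ring.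
  rewrite /g1 /g2 /green_integrand /a.
  move: (partial1 _ y) (partial2 _ y) (u y) (disc_weight x r y) wE Ly.
  move=> p1 p2 v w wE Ly.
  have {}Ly : p2 = - lambda ^+ 2 * v - p1.
    by apply/eqP; rewrite -subr_eq0 -Ly; apply/eqP; ring.
  rewrite Ly !(exprMn _ (- 2 * _)) !(exprMn _ (- 2)) wE !exprS -[n.+2]addn1 natrD.
  by field; rewrite gt_eqF.
clearbody g1 g2.
have mD := disc_measurable x r0.
pose f m (y : R * R) := disc_weight x r y ^+ m * u y.
have ifM c m : mu2.-integrable (disc x r) (EFin \o (fun y => c * f m y)).
  by apply: disc_continuous_integrable => // y Ky; apply: cvgMr;
    apply: moment_continuous; exact: cu.
have if_ m : mu2.-integrable (disc x r) (EFin \o f m).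
  exact: moment_integrable.
have fE c m : (\int[mu2]_(y in disc x r) (c * f m y))%R = c * moment x r u m.
  exact: RintegralZl.
have := @RintegralD _ _ R mu2 _ g1 g2 mD ig1 ig2.
rewrite rows0 columns0 addr0.
rewrite (@eq_Rintegral _ _ R mu2 _ (fun y => (- lambda ^+ 2 * f n.+2 y) -
    (a * n.+1%:R * f n y - a * n.+2%:R * f n.+1 y))); last first.
  by move=> y /set_mem; exact: g12.
rewrite RintegralB//; last first.
  apply: disc_continuous_integrable => // y Ky.
  by apply: cvgB; apply: cvgMr; apply: moment_continuous; exact: cu.
rewrite RintegralB// !fE => H.
apply/esym/eqP; rewrite -subr_eq0; apply/eqP.
by apply: (etrans _ H); ring.
Qed.

Lemma mean_moment_recurrence (R : realType) (Omega : set (R * R)) (lambda : R)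
    (u : R * R -> R) (x : R * R) (r : R) (n : nat) :
  open Omega -> helmholtz_solution Omega lambda u -> admissible Omega x r ->
  mean_moment x r u n - mean_moment x r u n.+1 =
  - ((lambda * r / 2) ^+ 2) * mean_moment x r u n.+2 / (n.+2%:R * n.+3%:R).
Proof.
move=> oO Hu [r0 DO].
have rec := @moment_recurrence R Omega lambda u x r n oO Hu (conj r0 DO).
rewrite /mean_moment.
have p0 : pi != 0 :> R by rewrite gt_eqF// pi_gt0.
have r0' : r != 0 by rewrite gt_eqF.
have n20 : n.+2%:R != 0 :> R by rewrite pnatr_eq0.
have n30 : n.+3%:R != 0 :> R by rewrite pnatr_eq0.
move: (moment x r u n) (moment x r u n.+1) (moment x r u n.+2) rec => a b c.
move: n20 n30; move: (n.+1%:R : R) (n.+2%:R : R) (n.+3%:R : R) => N1 N2 N3.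
move: p0; move: (pi : R) => p p0 n20 n30 rec.
have -> : N1 / (p * r ^+ 2) * a - N2 / (p * r ^+ 2) * b =
    (4 * N2 / r ^+ 2 * (N1 * a - N2 * b)) / (4 * p * N2).
  by field; rewrite ?p0 ?n20 ?r0'.
by rewrite rec; field; rewrite ?p0 ?n20 ?n30 ?r0'.
Qed.

Lemma helmholtz_solution_cst1 (R : realType) :
  helmholtz_solution setT 0 (cst 1 : R * R -> R).
Proof.
have p1 (c : R) : partial1 (cst c) = cst 0.
  by apply/funext => y; rewrite /partial1 derive_cst.
have p2 (c : R) : partial2 (cst c) = cst 0.
  by apply/funext => y; rewrite /partial2 derive_cst.
have C1c (c : R) : C1_on setT (cst c : R * R -> R).
  move=> y _; rewrite p1 p2; split; [exact: derivable_cst|exact: derivable_cst| |];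
    exact: cst_continuous.
split; first by split; rewrite ?p1 ?p2; exact: C1c.
by move=> y _; rewrite /laplacian !(p1, p2) /cst/=; ring.
Qed.

(** With lambda = 0 the recurrence for the constant 1 has no right-hand side, so
    it computes the integral of every power of the weight from the area. *)
Lemma mean_moment_cst1 (R : realType) (x : R * R) (r : R) (n : nat) : 0 < r ->
  mean_moment x r (cst 1) n = 1.
Proof.
move=> r0; elim: n => [|n IH].
  rewrite /mean_moment /moment (@eq_Rintegral _ _ R mu2 _ (cst 1)); last first.
    by move=> y _; rewrite expr0 mul1r.
  rewrite Rintegral_cst; last exact: disc_measurable.
  have -> : fine (mu2 (disc x r)) = pi * r ^+ 2 by rewrite disc_area.
  by rewrite !mul1r mulVf// mulf_neq0 ?expf_neq0 ?gt_eqF ?pi_gt0.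
have ad : admissible setT x r by [].
have := @mean_moment_recurrence R setT 0 (cst 1) x r n openT
  (@helmholtz_solution_cst1 R) ad.
by rewrite IH !mul0r expr0n/= oppr0 !mul0r => /eqP; rewrite subr_eq0 => /eqP.
Qed.

Lemma moment_cst1 (R : realType) (x : R * R) (r : R) (n : nat) : 0 < r ->
  moment x r (cst 1) n = pi * r ^+ 2 / n.+1%:R.
Proof.
move=> r0; have p0 : pi * r ^+ 2 != 0 :> R.
  by rewrite mulf_neq0 ?expf_neq0 ?gt_eqF ?pi_gt0.
have := @mean_moment_cst1 R x r n r0; rewrite /mean_moment => H.
have N0 : n.+1%:R != 0 :> R by rewrite pnatr_eq0.
move: p0 N0 H; move: (pi * r ^+ 2) (n.+1%:R : R) (moment _ _ _ n).
by move=> p N m p0 N0 H; rewrite -[RHS]mulr1 -H; field; rewrite p0 N0.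
Qed.

(** * Backward recurrences and the Bessel function *)

(** Going down from index j+1 to j multiplies the bound by at most
    1 + kappa / ((j+1)(j+2)) <= exp (kappa / (j+1) - kappa / (j+2)).  These factors
    telescope, so smallness at infinity propagates down to index 0 at the
    cost of the fixed factor exp kappa. *)
Lemma backward_recurrence_unique (R : realType) (kappa : R) (d : nat -> R) :
  0 <= kappa -> d n @[n --> \oo] --> 0 ->
  (forall m, d m - d m.+1 = - kappa * d m.+2 / (m.+1%:R * m.+2%:R)) ->
  d 0%N = 0.
Proof.
move=> k0 d0 rec.
have bound (e : R) : 0 < e -> `|d 0%N| <= e * expR kappa.
  move=> e0; have /cvgrPdist_le /(_ e e0) [N _ dN] := d0.
  pose P j := `|d j| <= e * expR (kappa / j.+1%:R).
  have PN j : (N <= j)%N -> P j.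
    move=> /dN /=; rewrite sub0r normrN /P => /le_trans; apply.
    by rewrite ler_peMr ?(ltW e0)// -expR0 ler_expR divr_ge0.
  have step j : P j.+1 -> P j.+2 -> P j.
    rewrite /P => P1 P2.
    have j10 : 0 < j.+1%:R :> R by rewrite ltr0n.
    have j20 : 0 < j.+2%:R :> R by rewrite ltr0n.
    have j30 : 0 < j.+3%:R :> R by rewrite ltr0n.
    have -> : d j = d j.+1 - kappa / (j.+1%:R * j.+2%:R) * d j.+2.
      by rewrite -[LHS](subrK (d j.+1)) rec; ring.
    set q := kappa / (j.+1%:R * j.+2%:R).
    have q0 : 0 <= q by rewrite divr_ge0// mulr_ge0// ltW.
    apply: (@le_trans _ _ (e * expR (kappa / j.+2%:R) * (1 + q))).
      rewrite (le_trans (ler_normB _ _))// mulrDr mulr1 lerD// normrM ger0_norm//.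
      rewrite mulrC ler_wpM2r// (le_trans P2)// ler_pM2l// ler_expR.
      by rewrite ler_wpM2l// lef_pV2 ?posrE// ler_nat.
    rewrite -mulrA ler_pM2l// (le_trans (ler_wpM2l (expR_ge0 _) (expR_ge1Dx q)))//.
    rewrite -expRD ler_expR le_eqVlt; apply/orP; left; apply/eqP; rewrite /q.
    rewrite -[j.+2]addn1 natrD in j20 *; move: (j.+1%:R : R) j10 j20 => z z1 z2.
    by field; rewrite !gt_eqF.
  suff : forall i, P (N - i)%N /\ P (N - i).+1.
    by move=> /(_ N)[]; rewrite subnn /P divr1.
  elim=> [|i [IH1 IH2]]; first by rewrite subn0; split; apply: PN.
  have [Ni|iN] := leqP N i.
    have e1 : (N - i.+1 = 0)%N by apply/eqP; rewrite subn_eq0 ltnW.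
    have e2 : (N - i = 0)%N by apply/eqP; rewrite subn_eq0.
    by rewrite e2 in IH1 IH2; rewrite e1.
  rewrite -subnSK// in IH1 IH2.
  by split => //; apply: step.
apply/eqP; rewrite -normr_le0; apply/ler_addgt0Pl => e e0; rewrite addr0.
have ek : 0 < e / expR kappa by rewrite divr_gt0// expR_gt0.
by have := bound _ ek; rewrite divfK// gt_eqF// expR_gt0.
Qed.

(** Terms of the Bessel-Clifford series 0F1(; m+1; -kappa), that is
    m! kappa^(-m/2) J_m(2 sqrt kappa).  The normalisation by m! makes the value
    tend to 1 as m grows. *)
Definition clifford_coef {R : realType} (kappa : R) (m k : nat) : R :=
  (- kappa) ^+ k * m`!%:R / (k`!%:R * (k + m)`!%:R).

Definition clifford {R : realType} (kappa : R) (m : nat) : R :=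
  limn (series (clifford_coef kappa m)).

Lemma fact_neq0 (R : realType) n : n`!%:R != 0 :> R.
Proof. by rewrite pnatr_eq0 -lt0n fact_gt0. Qed.

Lemma clifford_coef0 (R : realType) (kappa : R) m : clifford_coef kappa m 0 = 1.
Proof. by rewrite /clifford_coef expr0 add0n fact0 !mul1r divff// fact_neq0. Qed.

Lemma clifford_coef_bound (R : realType) (kappa : R) m k : 0 <= kappa ->
  `|clifford_coef kappa m k.+1| <= exp_coeff kappa k.+1 / m.+1%:R.
Proof.
move=> k0; rewrite /clifford_coef !normrM normrX normrN normfV.
rewrite normrM !normr_nat.
have -> : exp_coeff kappa k.+1 = kappa ^+ k.+1 / k.+1`!%:R by [].
rewrite invfM -!mulrA (ger0_norm k0) ler_wpM2l ?exprn_ge0//.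
rewrite mulrCA ler_wpM2l ?invr_ge0//.
rewrite ler_pdivrMr ?ltr0n ?fact_gt0// mulrC ler_pdivlMr ?ltr0n//.
rewrite -natrM ler_nat mulnC -factS addSnnS (fact_split (leq_addl k m.+1)).
by rewrite leq_pmulr// big_add1 prodn_gt0.
Qed.

Lemma is_cvg_clifford (R : realType) (kappa : R) m : 0 <= kappa ->
  cvgn (series (clifford_coef kappa m)).
Proof.
move=> k0; apply: normed_cvg; apply: series_le_cvg (is_cvg_series_exp_coeff kappa).
- by move=> n; exact: normr_ge0.
- by move=> n; exact: exp_coeff_ge0.
- move=> [|n] /=.
    by rewrite clifford_coef0 normr1 /exp_coeff/= expr0 fact0 divr1.
  rewrite (le_trans (clifford_coef_bound _ _ k0))// ler_piMr ?exp_coeff_ge0//.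
  by rewrite invf_le1 ?ltr0n// ler1n.
Qed.

Lemma clifford_coef_recurrence (R : realType) (kappa : R) m k :
  clifford_coef kappa m k.+1 - clifford_coef kappa m.+1 k.+1 =
  - kappa * clifford_coef kappa m.+2 k / (m.+1%:R * m.+2%:R).
Proof.
have -> : clifford_coef kappa m k.+1 =
    (- kappa) ^+ k.+1 * m`!%:R / (k.+1`!%:R * (k + m).+1`!%:R) by [].
have -> : clifford_coef kappa m.+1 k.+1 =
    (- kappa) ^+ k.+1 * m.+1`!%:R / (k.+1`!%:R * (k + m).+2`!%:R).
  by rewrite /clifford_coef addSnnS !addnS.
have -> : clifford_coef kappa m.+2 k =
    (- kappa) ^+ k * m.+2`!%:R / (k`!%:R * (k + m).+2`!%:R).
  by rewrite /clifford_coef !addnS.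
have := fact_neq0 R m; have := fact_neq0 R k; have := fact_neq0 R (k + m).
have S0 n : n.+1%:R != 0 :> R by rewrite pnatr_eq0.
have := S0 k; have := S0 m; have := S0 m.+1.
have := S0 (k + m)%N; have := S0 (k + m).+1.
rewrite !factS !natrM exprS.
rewrite -[m.+2]addn1 -[(k + m).+2]addn1 !natrD -addSn natrD.
have -> : m%:R = m.+1%:R - 1 :> R by rewrite -natr1 addrK.
move: (k.+1%:R : R) (m.+1%:R : R) (m`!%:R : R) (k`!%:R : R) ((k + m)`!%:R : R).
move: ((- kappa) ^+ k) => z x y a b c x1 x2 x3 x4 x5 x6 x7 x8.
by field; rewrite ?x1 ?x2 ?x3 ?x4 ?x5 ?x6 ?x7 ?x8.
Qed.

Lemma clifford_recurrence (R : realType) (kappa : R) m : 0 <= kappa ->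
  clifford kappa m - clifford kappa m.+1 =
  - kappa * clifford kappa m.+2 / (m.+1%:R * m.+2%:R).
Proof.
move=> k0; set a := - kappa / (m.+1%:R * m.+2%:R).
have cE j : series (clifford_coef kappa j) n @[n --> \oo] --> clifford kappa j.
  exact: is_cvg_clifford.
have L : (series (clifford_coef kappa m) n.+1 -
   series (clifford_coef kappa m.+1) n.+1) @[n --> \oo] -->
   clifford kappa m - clifford kappa m.+1.
  apply: cvgB; rewrite (cvg_shiftS (series _)); exact: cE.
rewrite [RHS](_ : _ = a * clifford kappa m.+2); last by rewrite /a mulrAC.
apply: (cvg_unique _ L); first exact: Rhausdorff.
rewrite (_ : (fun n => _) = (fun n => a * series (clifford_coef kappa m.+2) n)).
  by apply: cvgMr; exact: cE.
apply/funext => n; rewrite /series/= !big_nat_recl// !clifford_coef0.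
rewrite opprD addrACA subrr add0r -sumrB mulr_sumr; apply: eq_bigr => k _.
by rewrite clifford_coef_recurrence /a mulrAC.
Qed.

Lemma clifford_cvg1 (R : realType) (kappa : R) : 0 <= kappa ->
  clifford kappa m @[m --> \oo] --> (1 : R).
Proof.
move=> k0.
have B m : `|1 - clifford kappa m| <= expR kappa / m.+1%:R.
  have L : (`|1 - series (clifford_coef kappa m) n.+1|) @[n --> \oo] -->
      `|1 - clifford kappa m|.
    apply: cvg_norm; apply: cvgB; first exact: cvg_cst.
    rewrite (cvg_shiftS (series _)); exact: is_cvg_clifford.
  apply: (ler_cvg_to L (cvg_cst _)); apply: nearW => n.
  rewrite /series/= big_nat_recl// clifford_coef0 opprD addrA subrr sub0r normrN.
  rewrite (le_trans (ler_norm_sum _ _ _))//.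
  apply: (@le_trans _ _ (\sum_(0 <= i < n) exp_coeff kappa i.+1 / m.+1%:R)).
    by apply: ler_sum => i _; exact: clifford_coef_bound.
  rewrite -mulr_suml ler_wpM2r// (@le_trans _ _ (series (exp_coeff kappa) n.+1))//.
    by rewrite /series/= big_nat_recl// lerDr exp_coeff_ge0.
  apply: nondecreasing_cvgn_le; last exact: is_cvg_series_exp_coeff.
  by apply: nondecreasing_series => i _ _; exact: exp_coeff_ge0.
apply/cvgrPdist_le => e e0; near=> m; rewrite (le_trans (B m))//.
rewrite ler_pdivrMr ?ltr0n// mulrC -ler_pdivrMr//.
apply: (@le_trans _ _ m%:R); last by rewrite ler_nat.
by near: m; exact: nbhs_infty_ger.
Unshelve. all: by end_near. Qed.

Lemma bessel_J0_clifford (R : realType) (t : R) :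
  bessel_J0 t = clifford ((t / 2) ^+ 2) 0.
Proof.
rewrite /bessel_J0 /clifford; congr (limn (series _)); apply/funext => k.
rewrite /clifford_coef addn0 fact0 mulr1 -expr2 mulrAC; congr (_ / _).
by rewrite -[- (_ ^+ 2)]mulN1r [RHS]exprMn -exprM.
Qed.

(** Shifted by one and prolonged by M (-1) := M 0 - kappa M 1 / 2, the sequence M
    satisfies the recurrence of the Bessel-Clifford functions from index 0 on;
    M and l times those functions have the same limit l, hence they agree at
    index 0. *)
Lemma bessel_of_recurrence (R : realType) (t l : R) (M : nat -> R) :
  (forall n, M n - M n.+1 = - (t / 2) ^+ 2 * M n.+2 / (n.+2%:R * n.+3%:R)) ->
  M n @[n --> \oo] --> l ->
  M 0 - (t / 2) ^+ 2 * M 1 / 2 = l * bessel_J0 t.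
Proof.
move=> rec Ml; set kappa := (t / 2) ^+ 2 in rec *.
have k0 : 0 <= kappa by exact: sqr_ge0.
pose a n := if n is k.+1 then M k else M 0 - kappa * M 1 / 2.
pose d n := a n - l * clifford kappa n.
suff : d 0 = 0 by move/eqP; rewrite subr_eq0 bessel_J0_clifford => /eqP.
apply: (backward_recurrence_unique k0).
  rewrite -(subrr l) -{2}[l]mulr1; apply: cvgB.
    by rewrite -(cvg_shiftS a).
  by apply: cvgMr; exact: clifford_cvg1.
move=> m; rewrite /d.
have aE : a m - a m.+1 = - kappa * a m.+2 / (m.+1%:R * m.+2%:R).
  case: m => [|m] /=; last exact: rec.
  by field.
have cE := @clifford_recurrence R kappa m k0.
rewrite mulrBr mulrBl -aE [l * _]mulrC [l * clifford _ m.+2]mulrC mulrA mulrAC -cE.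
ring.
Qed.

(** * Concentration of the moments at the centre *)

(** With s the square root of q, (n+1) s^n is at most 1 / (1 - s) because
    (n+1) s^n <= 1 + s + ... + s^n; the other factor s^n tends to 0. *)
Lemma cvg_mulrn_geometric (R : realType) (q : R) : 0 <= q -> q < 1 ->
  n.+1%:R * q ^+ n @[n --> \oo] --> 0.
Proof.
move=> q0 q1; pose s := Num.sqrt q.
have s0 : 0 <= s by exact: sqrtr_ge0.
have sq : s ^+ 2 = q by rewrite sqr_sqrtr.
have s1 : s < 1 by rewrite -(@ltr_pXn2r _ 2) ?nnegrE// sq expr1n.
have s10 : 0 < 1 - s by rewrite subr_gt0.
have bound n : n.+1%:R * (1 - s) * s ^+ n <= 1 - s ^+ n.+1.
  elim: n => [|n IH]; first by rewrite mul1r expr0 mulr1 expr1.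
  have := ler_wpM2l s0 IH.
  have : s ^+ n.+1 * (1 - s) <= 1 - s.
    by rewrite ler_piMl ?(ltW s10)// exprn_ile1// ltW.
  rewrite -[n.+2%:R]natr1 !exprS; move: (s ^+ n) (n.+1%:R : R) => a b H1 H2.
  by lra.
apply: (@squeeze_cvgr _ _ _ _ (cst 0) (fun n => (1 - s)^-1 * s ^+ n)).
- apply: nearW => n; rewrite mulr_ge0 ?exprn_ge0//= -sq exprAC expr2 mulrA.
  rewrite ler_wpM2r ?exprn_ge0// -[leRHS]mul1r ler_pdivlMr// mulrAC.
  by rewrite (le_trans (bound n))// gerBl exprn_ge0.
- exact: cvg_cst.
- rewrite -[X in _ --> X](mulr0 (1 - s)^-1); apply: cvgMr.
  by apply: cvg_expr; rewrite ger0_norm.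
Qed.

(** The averages are taken against the probability densities
    (n+1) w^n / (pi r^2), and w^n decays geometrically, faster than 1 / (n+1),
    away from the centre, where w is at most q < 1. *)
Lemma mean_moment_cvg (R : realType) (x : R * R) (r : R) (u : R * R -> R) :
  0 < r -> (forall y, closed_disc x r y -> {for y, continuous u}) ->
  mean_moment x r u n @[n --> \oo] --> u x.
Proof.
move=> r0 cu; have [M M0 uM] := closed_disc_bounded r0 cu.
have Kx : closed_disc x r x.
  by rewrite /closed_disc /= !subrr expr0n/= addr0 sqr_ge0.
apply/cvgrPdist_le => e e0.
have e20 : 0 < e / 2 by rewrite divr_gt0.
have /cvgrPdist_le /(_ _ e20) /nbhs_ballP[d /= d0 du] := cu x Kx.
(* the bound of the weight outside the square of half-side d; the minimum with
   r only serves to keep q nonnegative *)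
pose q := 1 - (Num.min d r / r) ^+ 2.
have m0 : 0 < Num.min d r / r by rewrite divr_gt0// lt_min d0.
have q0 : 0 <= q.
  by rewrite /q subr_ge0 expr_le1 ?(ltW m0)// ler_pdivrMr// mul1r ge_min lexx orbT.
have q1 : q < 1 by rewrite /q gtrBl exprn_gt0.
have far n y : disc x r y -> disc_weight x r y ^+ n * `|u y - u x| <=
    e / 2 * (disc_weight x r y ^+ n * 1) + (2 * M) * q ^+ n.
  move=> Dy; have w0 : 0 <= disc_weight x r y by apply/ltW/disc_weight_gt0.
  have [By|By] := pselect (ball x d y).
    rewrite mulr1 mulrC ler_wpDr// ?mulr_ge0 ?exprn_ge0 ?(ltW M0)//.
    rewrite ler_wpM2r ?exprn_ge0// distrC; exact: du.
  apply: (@le_trans _ _ (2 * M * q ^+ n)); last first.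
    by rewrite lerDr mulr_ge0 ?(ltW e20)// mulr1 exprn_ge0.
  rewrite mulrC; apply: ler_pM; rewrite ?exprn_ge0//.
    by rewrite (le_trans (ler_normB _ _))// mulr2n mulrDl mul1r lerD// uM//;
      exact: disc_sub_closed_disc.
  rewrite lerXn2r ?nnegrE// /disc_weight /q lerD2l lerN2 expr_div_n.
  rewrite ler_wpM2r ?invr_ge0 ?sqr_ge0//.
  have far1 (a b : R) : ~ `|a - b| < d -> Num.min d r ^+ 2 <= (b - a) ^+ 2.
    move/negP; rewrite -leNgt distrC => dab; rewrite -[leRHS]real_normK ?num_real//.
    rewrite ler_pXn2r ?nnegrE// ?le_min ?(ltW d0) ?(ltW r0)//.
    by rewrite (le_trans _ dab)// ge_min lexx.
  have : ~ `|x.1 - y.1| < d \/ ~ `|x.2 - y.2| < d.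
    by apply/not_andP => -[H1 H2]; apply: By; split.
  case=> /far1 /le_trans; apply; first by rewrite lerDl sqr_ge0.
  by rewrite lerDr sqr_ge0.
pose v y := u y - u x.
have cv y : closed_disc x r y -> {for y, continuous v}.
  by move=> Ky; apply: cvgB; [exact: cu|exact: cvg_cst].
have c1 y : closed_disc x r y -> {for y, continuous (cst (1 : R) : R * R -> R)}.
  by move=> _; exact: cst_continuous.
have mD := disc_measurable x r0.
have area : fine (mu2 (disc x r)) = pi * r ^+ 2 by rewrite disc_area.
have P0 : 0 < pi * r ^+ 2 :> R by rewrite mulr_gt0 ?pi_gt0 ?exprn_gt0.
have vE n : moment x r v n = moment x r u n - u x * moment x r (cst 1) n.
  rewrite /moment -RintegralZl//; last exact: moment_integrable.
  rewrite -RintegralB//; last 2 first.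
  - exact: moment_integrable.
  - apply: disc_continuous_integrable => // y Ky; apply: cvgMr.
    by apply: moment_continuous; exact: c1.
  by apply: eq_Rintegral => y _; rewrite /v /cst/=; ring.
have vB n : `|moment x r v n| <=
    e / 2 * (pi * r ^+ 2 / n.+1%:R) + 2 * M * q ^+ n * (pi * r ^+ 2).
  rewrite (le_trans (le_normr_Rintegral mD (moment_integrable n r0 cv)))//.
  have iw c : mu2.-integrable (disc x r)
      (EFin \o (fun y => c * (disc_weight x r y ^+ n * cst 1 y))).
    apply: disc_continuous_integrable => // y Ky; apply: cvgMr.
    by apply: moment_continuous; exact: c1.
  have ic (c : R) : mu2.-integrable (disc x r) (EFin \o (fun=> c)).
    by apply: disc_continuous_integrable => // y Ky; exact: cst_continuous.
  rewrite -(moment_cst1 x n r0) -area -Rintegral_cst// -RintegralZl//; last first.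
    exact: moment_integrable.
  rewrite -RintegralD//.
  apply: le_Rintegral => //.
  - exact: integrable_norm (moment_integrable n r0 cv).
  - apply: disc_continuous_integrable => // y Ky; apply: cvgD; last exact: cvg_cst.
    by apply: cvgMr; apply: moment_continuous; exact: c1.
  - move=> y Dy; rewrite normrM ger0_norm; first exact: far.
    by rewrite exprn_ge0//; apply/ltW/disc_weight_gt0.
have eM0 : 0 < e / 2 / (2 * M) by rewrite divr_gt0// mulr_gt0.
have /cvgrPdist_le /(_ _ eM0) H := cvg_mulrn_geometric q0 q1.
near=> n.
have N0 : 0 < n.+1%:R :> R by rewrite ltr0n.
have -> : u x - mean_moment x r u n = - (n.+1%:R / (pi * r ^+ 2) * moment x r v n).
  rewrite vE moment_cst1// /mean_moment.
  move: (pi * r ^+ 2) P0 (n.+1%:R : R) N0 => p p0 N N0.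
  by field; rewrite !gt_eqF.
have Hn : n.+1%:R * q ^+ n <= e / 2 / (2 * M).
  have : `|0 - n.+1%:R * q ^+ n| <= e / 2 / (2 * M) by near: n.
  by rewrite sub0r normrN ger0_norm// mulr_ge0 ?exprn_ge0// ltW.
rewrite normrN normrM gtr0_norm ?divr_gt0//.
apply: le_trans (ler_wpM2l _ (vB n)) _; first by rewrite ltW ?divr_gt0.
move: Hn; rewrite ler_pdivlMr ?mulr_gt0//.
move: (pi * r ^+ 2) P0 (n.+1%:R : R) N0 (q ^+ n) => p p0 N N0 Q HQ.
rewrite (_ : N / p * _ = e / 2 + N * Q * (2 * M)); first by lra.
by field; rewrite !gt_eqF.
Unshelve. all: by end_near. Qed.

(** * The logarithmic kernel as a power series in the weight *)

Definition log_partial {R : realType} (N : nat) (w : R) : R :=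
  \sum_(0 <= k < N) w ^+ k.+1 / k.+1%:R.

(** The derivative of the remainder is 1 / (1 - t) minus a geometric sum. *)
Lemma is_derive_log_remainder (R : realType) (N : nat) (t : R) : t < 1 ->
  is_derive t 1 (fun w : R => - ln (1 - w) - log_partial N w) (t ^+ N / (1 - t)).
Proof.
move=> t1; have t10 : 0 < 1 - t by rewrite subr_gt0.
elim: N => [|N IH].
  have -> : (fun w : R => - ln (1 - w) - log_partial 0 w) =
      (fun w : R => - ln (1 - w)).
    by apply/funext => w; rewrite /log_partial big_geq// subr0.
  have dln := is_derive1_ln t10.
  have d1 : is_derive t 1 (fun w : R => 1 - w) (- 1).
    by apply: is_derive_eq; rewrite add0r mul1r.
  have := @is_derive1_comp R (@ln R) (fun w => 1 - w) t _ _ dln d1.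
  move=> dc; apply: is_derive_eq; rewrite /GRing.scale/=; field.
  by rewrite gt_eqF.
have -> : (fun w : R => - ln (1 - w) - log_partial N.+1 w) =
    (fun w : R => (- ln (1 - w) - log_partial N w) - (N.+1%:R)^-1 * w ^+ N.+1).
  apply/funext => w; rewrite /log_partial big_nat_recr//= opprD addrA.
  by rewrite [_ / N.+1%:R]mulrC.
have dX : is_derive t 1 (fun w : R => w ^+ N.+1) (N.+1%:R * t ^+ N).
  have -> : (fun w : R => w ^+ N.+1) = (@id R) ^+ N.+1.
    by apply/funext => s; rewrite fctE.
  by apply: is_derive_eq; rewrite /GRing.scale/= mulr1 -mulr_natl.
apply: is_derive_eq; rewrite /GRing.scale/= exprS.
have N0 : N.+1%:R != 0 :> R by rewrite pnatr_eq0.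
by move: (N.+1%:R : R) N0 => z z0; field; rewrite z0 gt_eqF.
Qed.

Lemma derive_bound_unit_itv (R : realType) (f g : R -> R) (a b C : R) :
  a <= b -> b <= a + 1 -> f a = 0 ->
  (forall t : R, t \in `[a, b] -> is_derive t 1 f (g t)) ->
  (forall t : R, t \in `[a, b] -> 0 <= g t <= C) -> 0 <= f b <= C.
Proof.
move=> ab b1 fa df gC.
have cf : {within `[a, b], continuous f}.
  by apply: derivable_within_continuous => t /df dft; exact: ex_derive.
have dfoo (t : R) (tab : t \in `]a, b[) := df t (subset_itv_oo_cc tab).
have [t tab fE] := MVT_segment ab dfoo cf.
have /andP[g0 gt] := gC t tab.
have -> : f b = g t * (b - a) by rewrite -fE fa subr0.
rewrite mulr_ge0 ?subr_ge0//=.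
by rewrite (le_trans _ gt)// ler_piMr// lerBlDl.
Qed.

Lemma log_remainder_bound (R : realType) (N : nat) (w : R) : 0 <= w -> w < 1 ->
  0 <= - ln (1 - w) - log_partial N w <= w ^+ N / (1 - w).
Proof.
move=> w0 w1.
apply: (@derive_bound_unit_itv R (fun t => - ln (1 - t) - log_partial N t)
  (fun t => t ^+ N / (1 - t)) 0 w _ w0).
- by rewrite add0r ltW.
- rewrite subr0 ln1 oppr0 sub0r /log_partial big1 ?oppr0// => k _.
  by rewrite expr0n mul0r.
- move=> t; rewrite in_itv/= => /andP[_ tw]; apply: is_derive_log_remainder.
  exact: le_lt_trans tw w1.
- move=> t; rewrite in_itv/= => /andP[t0 tw].
  have t1 : 0 < 1 - t by rewrite subr_gt0 (le_lt_trans tw).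
  have w10 : 0 < 1 - w by rewrite subr_gt0.
  rewrite divr_ge0 ?exprn_ge0 ?(ltW t1)//=.
  rewrite ler_pM ?exprn_ge0 ?invr_ge0 ?(ltW t1)//.
    by rewrite lerXn2r// nnegrE.
  by rewrite lef_pV2 ?posrE// lerD2l lerN2.
Qed.

Lemma log_partial_cvg (R : realType) (w : R) : 0 <= w -> w < 1 ->
  log_partial N w @[N --> \oo] --> - ln (1 - w).
Proof.
move=> w0 w1.
have : (- ln (1 - w) - log_partial N w) @[N --> \oo] --> (0 : R).
  apply: (@squeeze_cvgr _ _ _ _ (cst 0) (fun N => w ^+ N / (1 - w))).
  - by apply: nearW => N; exact: log_remainder_bound.
  - exact: cvg_cst.
  - rewrite -[X in _ --> X](mul0r (1 - w)^-1); apply: cvgMl.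
    by apply: cvg_expr; rewrite ger0_norm.
move=> H; rewrite -[X in _ --> X]subr0.
rewrite (_ : (fun N => log_partial N w) =
  (fun N => - ln (1 - w) - (- ln (1 - w) - log_partial N w))); last first.
  by apply/funext => N; ring.
by apply: cvgB => //; exact: cvg_cst.
Qed.

Lemma disc_weight_lt1 (R : realType) (x : R * R) (r : R) (y : R * R) :
  0 < r -> y <> x -> disc_weight x r y < 1.
Proof.
move=> r0 yx; rewrite gtrBl divr_gt0 ?exprn_gt0//.
rewrite lt0r addr_ge0 ?sqr_ge0// andbT paddr_eq0 ?sqr_ge0// !sqrf_eq0 !subr_eq0.
apply/negP => /andP[/eqP e1 /eqP e2]; apply: yx.
by rewrite [LHS]surjective_pairing e1 e2 -surjective_pairing.
Qed.

(** 1 - w is the square of |x - y| / r.  At y = x both sides are 0, by the values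
    of the inverse and of the logarithm at 0. *)
Lemma ln_ratio_disc_weight (R : realType) (x : R * R) (r : R) (y : R * R) :
  0 < r -> ln (r / euclid (x - y)) = - ln (1 - disc_weight x r y) / 2.
Proof.
move=> r0; have [->|/eqP yx] := eqVneq y x.
  rewrite disc_weight_center /euclid /= !subrr expr0n/= addr0 sqrtr0 invr0 mulr0.
  by rewrite ln0// oppr0 mul0r.
have w1 := disc_weight_lt1 r0 yx.
have sE : euclid (x - y) ^+ 2 = (1 - disc_weight x r y) * r ^+ 2.
  by rewrite sqr_euclid /disc_weight /=; field; rewrite gt_eqF.
have e0 : 0 < euclid (x - y).
  rewrite lt0r euclid_ge0 andbT -sqrf_eq0 sE mulf_neq0 ?expf_neq0 ?gt_eqF//.
  by rewrite subr_gt0.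
have q0 : 0 < r / euclid (x - y) by rewrite divr_gt0.
have -> : 1 - disc_weight x r y = ((r / euclid (x - y)) ^+ 2)^-1.
  by rewrite expr_div_n sE invf_div mulfK// expf_neq0// gt_eqF.
by rewrite lnV ?posrE ?exprn_gt0// opprK lnXn// -[ln _ *+ 2]mulr_natr mulfK.
Qed.

Lemma log_partial_continuous (R : realType) (N : nat) :
  continuous (@log_partial R N).
Proof.
elim: N => [|N IH] t.
  rewrite (_ : log_partial 0 = cst 0); first exact: cst_continuous.
  by apply/funext => w; rewrite /log_partial big_geq.
rewrite (_ : log_partial N.+1 =
    (fun w => log_partial N w + w ^+ N.+1 / N.+1%:R)); last first.
  by apply/funext => w; rewrite /log_partial big_nat_recr.
by apply: cvgD; [exact: IH|apply: cvgMl; exact: exprn_continuous].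
Qed.

Lemma log_partial_weight_continuous (R : realType) (x : R * R) (r : R)
    (u : R * R -> R) N y : {for y, continuous u} ->
  {for y, continuous (fun y => log_partial N (disc_weight x r y) * u y)}.
Proof.
move=> cu; apply: cvgM => //.
apply: (@continuous_comp _ _ _ (disc_weight x r) (@log_partial R N)).
  exact: disc_weight_continuous.
exact: log_partial_continuous.
Qed.

Lemma integral_log_partial (R : realType) (x : R * R) (r : R) (u : R * R -> R) N :
  0 < r -> (forall y, closed_disc x r y -> {for y, continuous u}) ->
  (\int[mu2]_(y in disc x r) (log_partial N (disc_weight x r y) * u y)%:E =
  (\sum_(0 <= k < N) moment x r u k.+1 / k.+1%:R)%:E)%E.
Proof.
move=> r0 cu; have mD := disc_measurable x r0.
have iS n : mu2.-integrable (disc x r)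
    (EFin \o (fun y => log_partial n (disc_weight x r y) * u y)).
  apply: disc_continuous_integrable => // y Ky.
  by apply: log_partial_weight_continuous; exact: cu.
rewrite -[LHS]fineK; last exact: integrable_fin_num (iS N).
congr (_%:E); change (fine _) with
  (\int[mu2]_(y in disc x r) (log_partial N (disc_weight x r y) * u y))%R.
elim: N => [|N IH].
  rewrite big_geq// (@eq_Rintegral _ _ R mu2 _ (cst 0)) ?Rintegral_cst ?mul0r//.
  by move=> y _; rewrite /log_partial big_geq// mul0r.
rewrite big_nat_recr//= -IH mulrC -RintegralZl//; last exact: moment_integrable.
rewrite -RintegralD//; last first.
  apply: disc_continuous_integrable => // y Ky; apply: cvgMr.
  by apply: moment_continuous; exact: cu.
by apply: eq_Rintegral => y _; rewrite /log_partial big_nat_recr//=; ring.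
Qed.

Lemma sum_inv_consecutive (R : realType) N :
  \sum_(0 <= k < N) (k.+2%:R)^-1 / k.+1%:R = 1 - (N.+1%:R)^-1 :> R.
Proof.
elim: N => [|N IH]; first by rewrite big_geq// invr1 subrr.
rewrite big_nat_recr//= IH.
have : N.+2%:R != 0 :> R by rewrite pnatr_eq0.
have : N.+1%:R != 0 :> R by rewrite pnatr_eq0.
rewrite -[N.+2%:R]natr1; move: (N.+1%:R : R) => z z0 z1.
by field; rewrite z0 z1.
Qed.

(** By monotone convergence, the integral is bounded by the sum of the integrals
    of w^(k+1) / (k+1), namely of pi r^2 / ((k+1)(k+2)), which telescopes. *)
Lemma log_weight_integrable (R : realType) (x : R * R) (r : R) : 0 < r ->
  mu2.-integrable (disc x r) (EFin \o (fun y => - ln (1 - disc_weight x r y))).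
Proof.
move=> r0; have mD := disc_measurable x r0.
pose w := disc_weight x r.
have w01 y : disc x r y -> 0 <= w y <= 1.
  by move=> Dy; rewrite disc_weight_le1 andbT; apply/ltW/disc_weight_gt0.
pose L y := - ln (1 - w y).
have L0 y : disc x r y -> 0 <= L y.
  move=> /w01 /andP[? ?]; rewrite oppr_ge0 ln_le0//; lra.
have mw : measurable_fun (disc x r) (w : plane R -> R).
  apply: continuous_open_measurable_fun; first exact: disc_open.
  by move=> y _; exact: disc_weight_continuous.
have mL : measurable_fun (disc x r) (L : plane R -> R).
  apply: measurableT_comp => //; apply: measurableT_comp; first exact: measurable_ln.
  by apply: measurable_funB.
apply/integrableP; split; first exact/measurable_EFinP.
pose g N (y : plane R) : \bar R := (log_partial N (w y))%:E.
have g0 N y : disc x r y -> (0 <= g N y)%E.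
  move=> /w01 /andP[wy0 _]; rewrite lee_fin; apply: sumr_ge0 => k _.
  by rewrite divr_ge0// exprn_ge0.
have gnd y : disc x r y -> {homo g^~ y : m n / (m <= n)%N >-> (m <= n)%E}.
  move=> /w01 /andP[wy0 _]; apply/nondecreasing_seqP => N.
  rewrite lee_fin /log_partial big_nat_recr//= lerDl.
  by rewrite divr_ge0// exprn_ge0.
have mg N : measurable_fun (disc x r) (g N).
  apply/measurable_EFinP; apply: continuous_open_measurable_fun.
    exact: disc_open.
  move=> y _; apply: (@continuous_comp _ _ _ w (@log_partial R N)).
    exact: disc_weight_continuous.
  exact: log_partial_continuous.
have iL : (\int[mu2]_(y in disc x r) `|(L y)%:E| <=
    \int[mu2]_(y in disc x r) limn (g^~ y))%E.
  apply: ge0_le_integral => //.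
  - by apply: measurableT_comp => //; exact/measurable_EFinP.
  - apply: emeasurable_fun_cvg mg _ => y Dy.
    exact: ereal_nondecreasing_is_cvgn (gnd y Dy).
  - move=> y Dy; rewrite gee0_abs ?lee_fin ?L0//.
    have [->|/eqP yx] := eqVneq y x.
      (* at the centre ln 0 = 0 whereas the series diverges *)
      have Dx : disc x r x by apply/disc_weight_gt0; rewrite // disc_weight_center.
      rewrite /L /w disc_weight_center subrr ln0// oppr0; apply: lime_ge.
        exact: ereal_nondecreasing_is_cvgn (gnd x Dx).
      by apply: nearW => N; exact: g0.
    have /andP[wy0 _] := w01 y Dy.
    have H := @log_partial_cvg R (w y) wy0 (disc_weight_lt1 r0 yx).
    suff -> : limn (g^~ y) = (L y)%:E by [].
    by apply/cvg_lim => //; apply: cvg_EFin => //; apply: nearW.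
apply: (le_lt_trans iL); rewrite monotone_convergence//.
apply: (@le_lt_trans _ _ (pi * r ^+ 2)%:E); last exact: ltry.
have gE N : (\int[mu2]_(y in disc x r) g N y =
    (pi * r ^+ 2 * (1 - N.+1%:R^-1))%:E)%E.
  rewrite -sum_inv_consecutive mulr_sumr.
  rewrite (_ : \sum_(0 <= k < N) _ =
      \sum_(0 <= k < N) moment x r (cst 1) k.+1 / k.+1%:R); last first.
    by apply: eq_bigr => k _; rewrite moment_cst1// mulrA.
  rewrite -integral_log_partial//; last by move=> y _; exact: cst_continuous.
  by apply: eq_integral => y _; rewrite /g mulr1.
apply: lime_le.
  apply: ereal_nondecreasing_is_cvgn => m n mn; rewrite !gE lee_fin.
  apply: ler_wpM2l; first by rewrite mulr_ge0 ?pi_ge0 ?sqr_ge0.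
  by rewrite lerD2l lerN2 lef_pV2 ?posrE// ler_nat.
apply: nearW => N; rewrite gE lee_fin.
by rewrite ger_pMr ?mulr_gt0 ?pi_gt0 ?exprn_gt0// gerBl.
Qed.

Lemma plane_pointE (R : realType) (x : R * R) :
  [set x] = [set x.1] `*` [set x.2] :> set (plane R).
Proof. by apply/seteqP; split=> [_ -> //|[a b] [/= -> ->]]; case: x. Qed.

Lemma plane_point_null (R : realType) (x : R * R) : (mu2 [set x] = 0)%E.
Proof.
by rewrite plane_pointE product_measure1E//= lebesgue_measure_set1 mul0e.
Qed.

Lemma ae_plane_point (R : realType) (x : R * R) (P : plane R -> Prop) :
  (forall y, y <> x -> P y) -> {ae mu2, forall y, P y}.
Proof.
move=> HP; exists [set x]; split; [|exact: plane_point_null|].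
  by rewrite plane_pointE; apply: measurableX.
by move=> y /= NP; apply: contrapT => yx; exact/NP/HP.
Qed.

(** Dominated convergence, with the bound M (- ln (1 - w)) for M a bound of
    |u|; the centre, where the series diverges, is a null set. *)
Lemma log_weight_integral (R : realType) (x : R * R) (r : R) (u : R * R -> R) :
  0 < r -> (forall y, closed_disc x r y -> {for y, continuous u}) ->
  mu2.-integrable (disc x r)
    (EFin \o (fun y => - ln (1 - disc_weight x r y) * u y)) /\
  ((\sum_(0 <= k < N) moment x r u k.+1 / k.+1%:R)%:E @[N --> \oo] -->
  \int[mu2]_(y in disc x r) (- ln (1 - disc_weight x r y) * u y)%:E)%E.
Proof.
move=> r0 cu; have mD := disc_measurable x r0.
have [M M0 uM] := closed_disc_bounded r0 cu.
pose w := disc_weight x r.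
pose L y := - ln (1 - w y).
have iL : mu2.-integrable (disc x r) (EFin \o L) := log_weight_integrable x r0.
have mu_ : measurable_fun (disc x r) (u : plane R -> R).
  apply: continuous_open_measurable_fun; first exact: disc_open.
  by move=> y /(disc_sub_closed_disc r0); exact: cu.
have mL : measurable_fun (disc x r) (L : plane R -> R).
  by apply/measurable_EFinP; exact: measurable_int iL.
have w01 y : disc x r y -> y <> x -> 0 <= w y /\ w y < 1.
  move=> Dy yx; rewrite disc_weight_lt1//; split => //.
  exact/ltW/disc_weight_gt0.
have [|||||iLu _ +] := @dominated_convergence _ _ _ mu2 (disc x r) mD
  (fun N y => (log_partial N (w y) * u y)%:E) (fun y => (L y * u y)%:E)
  (fun y => (M%:E * (EFin \o L) y)%E).
- move=> N; apply/measurable_EFinP; apply: continuous_open_measurable_fun.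
    exact: disc_open.
  move=> y /(disc_sub_closed_disc r0) Ky.
  by apply: log_partial_weight_continuous; exact: cu.
- by apply/measurable_EFinP; apply: measurable_funM.
- apply: (@ae_plane_point R x) => y yx Dy; have [wy0 wy1] := w01 y Dy yx.
  apply: cvg_EFin; first exact: nearW.
  by apply: cvgMl; exact: log_partial_cvg.
- exact: integrableZl.
- apply: (@ae_plane_point R x) => y yx N Dy; have [wy0 wy1] := w01 y Dy yx.
  have /andP[l1 l2] := log_remainder_bound N wy0 wy1.
  have S0 : 0 <= log_partial N (w y).
    by apply: sumr_ge0 => k _; rewrite divr_ge0// exprn_ge0.
  rewrite /= -EFinM lee_fin normrM mulrC (ger0_norm S0).
  apply: ler_pM => //; first exact/uM/disc_sub_closed_disc.
  by rewrite -subr_ge0.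
by under eq_fun do rewrite integral_log_partial//; split.
Qed.

(** Up to the factor pi r^2, kappa times the k-th term of the sum is the increment
    of the prolonged sequence of means given by the recurrence, so the sum
    telescopes; its lower end is the prolongation M (-1) = M 0 - kappa M 1 / 2. *)
Lemma log_moment_sum (R : realType) (kappa : R) (x : R * R) (r : R)
    (u : R * R -> R) (N : nat) : 0 < r ->
  (forall n, mean_moment x r u n - mean_moment x r u n.+1 =
    - kappa * mean_moment x r u n.+2 / (n.+2%:R * n.+3%:R)) ->
  kappa * \sum_(0 <= k < N.+1) moment x r u k.+1 / k.+1%:R =
  pi * r ^+ 2 * (mean_moment x r u N -
    (mean_moment x r u 0 - kappa * mean_moment x r u 1 / 2)).
Proof.
move=> r0 rec.
have mE k : moment x r u k.+1 / k.+1%:R =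
    pi * r ^+ 2 * (mean_moment x r u k.+1 / (k.+1%:R * k.+2%:R)).
  rewrite /mean_moment.
  have p0 : pi * r ^+ 2 != 0 :> R by rewrite mulf_neq0 ?expf_neq0 ?gt_eqF ?pi_gt0.
  have n1 : k.+1%:R != 0 :> R by rewrite pnatr_eq0.
  have n2 : k.+2%:R != 0 :> R by rewrite pnatr_eq0.
  move: (pi * r ^+ 2) (k.+1%:R : R) (k.+2%:R : R) p0 n1 n2 => p a b p0 a0 b0.
  by field; rewrite p0 a0 b0.
elim: N => [|N IH].
  by rewrite big_nat1 mE; field.
rewrite big_nat_recr//= mulrDr IH mE.
have -> : mean_moment x r u N.+1 = mean_moment x r u N -
    (mean_moment x r u N - mean_moment x r u N.+1) by ring.
rewrite rec; ring.
Qed.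

(** * The weighted mean value identity *)

Theorem theorem6 (R : realType) (lambda : R) (Omega : set (R * R))
    (u : R * R -> R) :
  lambda != 0 ->
  plane_domain Omega ->
  helmholtz_solution Omega lambda u ->
  forall (x : R * R) (r : R), admissible Omega x r ->
    (a_tilde (lambda * r) * u x)%:E =
    ((pi * r ^+ 2)^-1%:E *
      \int[lebesgue_measure \x lebesgue_measure]_(y in disc x r)
        (u y * ln (r / euclid (x - y)))%:E)%E.
Proof.
move=> l0 [_ oO _] Hu x r /[dup] ad [r0 DO].
have rec n := @mean_moment_recurrence R Omega lambda u x r n oO Hu ad.
have cu y : closed_disc x r y -> {for y, continuous u}.
  move=> Ky; have [[C1 _ _] _] := Hu; apply: (C1_on_continuous oO C1).
  by apply: DO; exact: closed_disc_sub_closure.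
have cM := mean_moment_cvg r0 cu.
have J0E := bessel_of_recurrence rec cM.
set kappa := (lambda * r / 2) ^+ 2 in rec J0E.
have k0 : kappa != 0 by rewrite !mulf_neq0 ?invr_neq0 ?pnatr_eq0 ?(gt_eqF r0).
(* the limit of the telescoped sums *)
pose l := pi * r ^+ 2 * (u x - u x * bessel_J0 (lambda * r)) / kappa.
have sumE N : \sum_(0 <= k < N.+1) moment x r u k.+1 / k.+1%:R =
    pi * r ^+ 2 * (mean_moment x r u N - u x * bessel_J0 (lambda * r)) / kappa.
  by rewrite -J0E -log_moment_sum// mulrC mulKf.
have [iLu cLu] := log_weight_integral r0 cu.
have intE : (\int[mu2]_(y in disc x r)
    (- ln (1 - disc_weight x r y) * u y)%:E = l%:E)%E.
  move: cLu; rewrite -cvg_shiftS => /cvg_lim <- //.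
  apply/cvg_lim => //; under eq_fun do rewrite sumE.
  apply: cvg_EFin; first exact: nearW.
  by apply: cvgMl; apply: cvgMr; apply: cvgB => //; exact: cvg_cst.
have -> : (\int[mu2]_(y in disc x r) (u y * ln (r / euclid (x - y)))%:E =
    (2^-1 * l)%:E)%E.
  rewrite EFinM -intE -integralZl//; last exact: disc_measurable.
  apply: eq_integral => y _; rewrite -EFinM ln_ratio_disc_weight//.
  by congr (_%:E); rewrite /=; field.
rewrite -EFinM; congr (_%:E); rewrite /a_tilde /l /kappa.
have p0 : pi != 0 :> R by rewrite gt_eqF ?pi_gt0.
move: (bessel_J0 _) (u x) (pi : R) p0 => J v p p0.
by field; rewrite p0 l0 gt_eqF.
Qed.
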